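(* Let $(\lambda_n)_{n\in\mathbb N}$ be a sequence in $(0,1)$ such that $\inf_{n\in\mathbb N}\lambda_n>0$ and $\sup_{n\in\mathbb N}\lambda_n<1$, and set $D=\{0,1\}^m\smallsetminus\{\mathbf 0\}$. For every $n\in\mathbb N$, let $\mathbf T_n\colon\mathbf H\to\mathbf H\colon\mathbf x\mapsto(T_{i,n}\mathbf x)_{1\le i\le m}$ be a quasinonexpansive operator where, for every $i\in\{1,\dots,m\}$, $T_{i,n}\colon\mathbf H\to H_i$ is measurable. Let $\boldsymbol x_0$ and $(\boldsymbol a_n)_{n\in\mathbb N}$ be $\mathbf H$-valued random variables, and let $(\boldsymbol\varepsilon_n)_{n\in\mathbb N}$ be identically distributed $D$-valued random variables. Iterate, for $n=0,1,\dots$ and for $i=1,\dots,m$, $$x_{i,n+1}=x_{i,n}+\varepsilon_{i,n}\lambda_n\big(T_{i,n}(x_{1,n},\dots,x_{m,n})+a_{i,n}-x_{i,n}\big),$$ and set $(\forall n\in\mathbb N)$ $\mathcal E_n=\sigma(\boldsymbol\varepsilon_n)$. In addition, assume that the following hold: (i) $\mathbf F=\bigcap_{n\in\mathbb N}\operatorname{Fix}\mathbf T_n\neq\varnothing$. (ii) $\sum_{n\in\mathbb N}\sqrt{\mathsf E(\|\boldsymbol a_n\|^2\mid\mathcal X_n)}<+\infty$. (iii) For every $n\in\mathbb N$, $\mathcal E_n$ and $\mathcal X_n$ are independent. (iv) $(\forall i\in\{1,\dots,m\})$ $p_i=\mathsf P[\varepsilon_{i,0}=1]>0$. Then $\mathbf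 T_n\boldsymbol x_n-\boldsymbol x_n\to\mathbf 0$ $\mathsf P$-a.s. Furthermore, suppose that: (v) $\mathfrak W(\boldsymbol x_n)_{n\in\mathbb N}\subset\mathbf F$ $\mathsf P$-a.s. Then $(\boldsymbol x_n)_{n\in\mathbb N}$ converges weakly $\mathsf P$-a.s. to an $\mathbf F$-valued random variable $\boldsymbol x$. If, in addition, (vi) $\mathfrak S(\boldsymbol x_n)_{n\in\mathbb N}\neq\varnothing$ $\mathsf P$-a.s., then $(\boldsymbol x_n)_{n\in\mathbb N}$ converges strongly $\mathsf P$-a.s. to $\boldsymbol x$.
   Context: $H_1,\dots,H_m$ are separable real Hilbert spaces and $\mathbf H=H_1\oplus\cdots\oplus H_m$ is their direct Hilbert sum; all norms are denoted $\|\cdot\|$, and $\mathbf x=(x_1,\dots,x_m)$ is a generic vector in $\mathbf H$. $(\Omega,\mathcal F,\mathsf P)$ is the underlying probability space; random variables with values in a Hilbert space are Borel-measurable maps from $\Omega$. Given a sequence $(\boldsymbol x_n)_{n\in\mathbb N}=(x_{1,n},\dots,x_{m,n})_{n\in\mathbb N}$ of $\mathbf H$-valued random variables, $\mathcal X_n=\sigma(\boldsymbol x_0,\dots,\boldsymbol x_n)$. Components: $\boldsymbol a_n=(a_{i,n})_{1\le i\le m}$, $\boldsymbol\varepsilon_n=(\varepsilon_{i,n})_{1\le i\le m}$. $\operatorname{Fix}\mathbf T$ is the fixed point set of $\mathbf T$; $\mathbf T\colon\mathbf H\to\mathbf H$ is quasinonexpansive if $\|\mathbf T\mathbf x-\mathbf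 z\|\le\|\mathbf x-\mathbf z\|$ for every $\mathbf z\in\operatorname{Fix}\mathbf T$ and every $\mathbf x\in\mathbf H$. $\mathfrak S(\cdot)$ and $\mathfrak W(\cdot)$ denote the sets of strong and weak sequential cluster points of a sequence (taken pointwise in $\omega$ for random sequences). Equalities and inequalities involving random variables are understood to hold $\mathsf P$-almost surely. *)

(* Defs.v *)
From HB Require Import structures.
From mathcomp Require Import all_boot all_order all_algebra.
From mathcomp Require Import all_classical all_reals all_analysis.
From mathcomp Require Import measurable_realfun ring lra.

Set Implicit Arguments.
Unset Strict Implicit.
Unset Printing Implicit Defensive.

Import Order.TTheory GRing.Theory Num.Theory.
Import numFieldNormedType.Exports.

Local Open Scope classical_set_scope.
Local Open Scope ring_scope.

HB.mixin Record CompleteNormedModule_isHilbert (R : realType) V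
    & CompleteNormedModule R V := {
  inner : V -> V -> R ;
  innerC : forall x y, inner x y = inner y x ;
  innerDl : forall x y z, inner (x + y) z = inner x z + inner y z ;
  innerZl : forall (k : R) x y, inner (k *: x) y = k * inner x y ;
  inner_normE : forall x, inner x x = `|x| ^+ 2
}.

#[short(type="hilbertType")]
HB.structure Definition Hilbert (R : realType) :=
  {V of CompleteNormedModule R V & CompleteNormedModule_isHilbert R V}.

(* Kept as an alias so that the Hilbert structure below does not compete with
   the product topology on dependent functions *)
Definition dsum (R : realType) (m : nat) (H : 'I_m -> hilbertType R) : Type :=
  forall i, H i.

Section direct_sum.
Context (R : realType) (m : nat) (H : 'I_m -> hilbertType R).
Implicit Types x y z : dsum H.

HB.instance Definition _ := gen_eqMixin (dsum H).
HB.instance Definition _ := gen_choiceMixin (dsum H).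

Definition dsum_add x y : dsum H := fun i => x i + y i.
Definition dsum_zero : dsum H := fun i => 0.
Definition dsum_opp x : dsum H := fun i => - x i.
Definition dsum_scale (k : R) x : dsum H := fun i => k *: x i.

Let dsum_addA : associative dsum_add.
Proof. by move=> x y z; apply: functional_extensionality_dep => i; exact: addrA. Qed.
Let dsum_addC : commutative dsum_add.
Proof. by move=> x y; apply: functional_extensionality_dep => i; exact: addrC. Qed.
Let dsum_add0 : left_id dsum_zero dsum_add.
Proof. by move=> x; apply: functional_extensionality_dep => i; exact: add0r. Qed.
Let dsum_addN : left_inverse dsum_zero dsum_opp dsum_add.
Proof. by move=> x; apply: functional_extensionality_dep => i; exact: addNr. Qed.

HB.instance Definition _ := GRing.isZmodule.Build (dsum H)
  dsum_addA dsum_addC dsum_add0 dsum_addN.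

Let dsum_scaleA k l x : dsum_scale k (dsum_scale l x) = dsum_scale (k * l) x.
Proof. by apply: functional_extensionality_dep => i; exact: scalerA. Qed.
Let dsum_scale1 : left_id 1 dsum_scale.
Proof. by move=> x; apply: functional_extensionality_dep => i; exact: scale1r. Qed.
Let dsum_scaleDr : right_distributive dsum_scale +%R.
Proof. by move=> k x y; apply: functional_extensionality_dep => i; exact: scalerDr. Qed.
Let dsum_scaleDl x : {morph dsum_scale^~ x : k l / k + l}.
Proof. by move=> k l; apply: functional_extensionality_dep => i; exact: scalerDl. Qed.

HB.instance Definition _ := GRing.Zmodule_isLmodule.Build R (dsum H)
  dsum_scaleA dsum_scale1 dsum_scaleDr dsum_scaleDl.

Definition dsum_inner x y : R := \sum_i inner (x i) (y i).
Definition dsum_norm x : R := Num.sqrt (\sum_i `|x i| ^+ 2).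

Lemma dsum_innerC x y : dsum_inner x y = dsum_inner y x.
Proof. by apply: eq_bigr => i _; exact: innerC. Qed.

Lemma dsum_innerDl x y z :
  dsum_inner (x + y) z = dsum_inner x z + dsum_inner y z.
Proof. by rewrite -big_split; apply: eq_bigr => i _; exact: innerDl. Qed.

Lemma dsum_innerZl k x y : dsum_inner (k *: x) y = k * dsum_inner x y.
Proof. by rewrite mulr_sumr; apply: eq_bigr => i _; exact: innerZl. Qed.

Let inner_Dr x y z : dsum_inner x (y + z) = dsum_inner x y + dsum_inner x z.
Proof. by rewrite dsum_innerC dsum_innerDl !(dsum_innerC x). Qed.

Let inner_Zr k x y : dsum_inner x (k *: y) = k * dsum_inner x y.
Proof. by rewrite dsum_innerC dsum_innerZl dsum_innerC. Qed.

Lemma dsum_normE x : dsum_inner x x = dsum_norm x ^+ 2.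
Proof.
rewrite sqr_sqrtr; first by apply: eq_bigr => i _; exact: inner_normE.
by apply: sumr_ge0 => i _; exact: sqr_ge0.
Qed.

Let norm_ge0 x : 0 <= dsum_norm x. Proof. exact: sqrtr_ge0. Qed.

Let norm0_eq0 x : dsum_norm x = 0 -> x = 0.
Proof.
move=> /eqP; rewrite sqrtr_eq0 => x0.
have {}x0 : \sum_i `|x i| ^+ 2 == 0.
  by rewrite eq_le x0 sumr_ge0// => i _; exact: sqr_ge0.
move: x0; rewrite psumr_eq0 => [/allP x0|i _]; last exact: sqr_ge0.
apply: functional_extensionality_dep => i.
by have := x0 i (mem_index_enum _); rewrite sqrf_eq0 normr_eq0 => /eqP.
Qed.

Let normZ k x : dsum_norm (k *: x) = `|k| * dsum_norm x.
Proof.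
apply/(pexpIrn (isT : (0 < 2)%N)); rewrite ?nnegrE ?mulr_ge0//.
rewrite exprMn -!dsum_normE dsum_innerZl dsum_innerC dsum_innerZl.
by rewrite mulrA -expr2 real_normK ?num_real.
Qed.

Let CauchySchwarz x y : dsum_inner x y <= dsum_norm x * dsum_norm y.
Proof.
have [y0|y0] := eqVneq (dsum_norm y) 0.
  rewrite y0 mulr0 (norm0_eq0 y0) -(scale0r (0 : dsum H)).
  by rewrite dsum_innerC dsum_innerZl mul0r.
have {}y0 : 0 < dsum_norm y by rewrite lt_neqAle eq_sym y0 norm_ge0.
have h b c : 0 <= b ^+ 2 * dsum_norm x ^+ 2 + 2 * (b * (c * dsum_inner x y))
    + c ^+ 2 * dsum_norm y ^+ 2.
  have := sqr_ge0 (dsum_norm (b *: x + c *: y)).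
  rewrite -(dsum_normE (_ + _)) dsum_innerDl !dsum_innerZl !inner_Dr !inner_Zr.
  by rewrite (dsum_innerC y x) !dsum_normE; nra.
move: {h}(h (dsum_norm y ^+ 2) (- dsum_inner x y)).
set a := dsum_norm x; set b := dsum_norm y; set c := dsum_inner x y => h.
have {}h : 0 <= b ^+ 2 * ((a * b) ^+ 2 - c ^+ 2) by nra.
rewrite pmulr_rge0 ?exprn_gt0// subr_ge0 in h.
apply: le_trans (ler_norm c) _; rewrite -ler_sqr ?nnegrE ?mulr_ge0 ?norm_ge0//.
by rewrite real_normK ?num_real.
Qed.

Let normD x y : dsum_norm (x + y) <= dsum_norm x + dsum_norm y.
Proof.
rewrite -ler_sqr ?nnegrE ?addr_ge0// -(dsum_normE (_ + _)) dsum_innerDl.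
rewrite !inner_Dr !dsum_normE (dsum_innerC y x).
by have := CauchySchwarz x y; nra.
Qed.

HB.instance Definition _ :=
  @Lmodule_isNormed.Build R (dsum H) dsum_norm normD normZ norm0_eq0.

Lemma dsum_normrE x : `|x| = Num.sqrt (\sum_i `|x i| ^+ 2).
Proof. by []. Qed.

Lemma dsum_norm_ge_coord x i : `|x i| <= `|x|.
Proof.
rewrite dsum_normrE -(ger0_norm (normr_ge0 (x i))) -sqrtr_sqr ler_wsqrtr//.
by rewrite (bigD1 i)//= lerDl sumr_ge0// => j _; exact: sqr_ge0.
Qed.

Lemma dsum_norm_le_sum x : `|x| <= \sum_i `|x i|.
Proof.
have s0 : 0 <= \sum_i `|x i| by rewrite sumr_ge0.
rewrite -ler_sqr ?nnegrE// -[`|x|]/(dsum_norm x) -dsum_normE.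
rewrite expr2 mulr_sumr; apply: ler_sum => i _.
rewrite inner_normE expr2 ler_wpM2r//.
by rewrite (bigD1 i)//= lerDl sumr_ge0.
Qed.

Let dsum_complete (F : set_system (dsum H)) :
  ProperFilter F -> cauchy F -> cvg F.
Proof.
move=> FF /cauchy_ballP Fc.
have Fi (i : 'I_m) : cvg ((fun x : dsum H => x i) @ F).
  apply: cauchy_cvg; apply/cauchy_ballP => e e0.
  have [[A B] /= [FA FB] AB] := Fc e e0.
  exists ((fun x : dsum H => x i) @` A, (fun x : dsum H => x i) @` B) => /=.
    by split; [apply: filterS FA|apply: filterS FB] => x ?; exists x.
  move=> [u v] /= [[x Ax <-] [y By <-]].
  have := AB (x, y) (conj Ax By); rewrite -!ball_normE /= => xy.
  exact: le_lt_trans (dsum_norm_ge_coord (x - y) i) xy.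
pose l : dsum H := fun i => lim ((fun x : dsum H => x i) @ F).
apply/cvg_ex; exists l; apply/cvgrPdist_lt => e e0.
have em : 0 < e / m.+1%:R by rewrite divr_gt0.
have Fl : \forall x \near F, forall i, `|l i - x i| < e / m.+1%:R.
  by apply: filter_forall => i; move/cvgrPdist_lt : (Fi i) => /(_ _ em).
apply: filterS Fl => /= x xl.
apply: le_lt_trans (dsum_norm_le_sum (l - (x : dsum H))) _.
have : \sum_i `|(l - (x : dsum H)) i| <= \sum_(i < m) e / m.+1%:R.
  by apply: ler_sum => i _; exact/ltW/(xl i).
move=> /le_lt_trans; apply.
rewrite sumr_const card_ord -(mulr_natr _ m) mulrAC ltr_pdivrMr// ltr_pM2l//.
by rewrite ltr_nat.
Qed.

HB.instance Definition _ := Uniform_isComplete.Build (dsum H) dsum_complete.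

HB.instance Definition _ := CompleteNormedModule_isHilbert.Build R (dsum H)
  dsum_innerC dsum_innerDl dsum_innerZl dsum_normE.

End direct_sum.

Section hilbert_notions.
Context (R : realType) (V : hilbertType R).
Implicit Types (u : nat -> V) (S : V -> V).

Definition separable := exists2 A : set V, countable A & dense A.

Definition weakly_cvg u (l : V) :=
  forall y, inner (u n) y @[n --> \oo] --> inner l y.

Definition weak_cluster u : set V := [set l | exists2 k : nat -> nat,
  {homo k : i j / (i < j)%N} & weakly_cvg (u \o k) l].

Definition strong_cluster u : set V := [set l | exists2 k : nat -> nat,
  {homo k : i j / (i < j)%N} & (u \o k) n @[n --> \oo] --> l].

Definition Fix S : set V := [set z | S z = z].

Definition quasinonexpansive S :=
  forall z, Fix S z -> forall x, `|S x - z| <= `|x - z|.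

Definition borel : set (set V) := <<s @open V>>.

Definition borelType := g_sigma_algebraType (@open V).

End hilbert_notions.
Arguments separable {R} V.
Arguments borel {R} V.
Arguments borelType {R} V.

(* {0,1}^m minus the zero vector *)
Definition sweep (m : nat) := {e : {ffun 'I_m -> bool} | e != [ffun=> false]}.

Section probability_notions.
Context d (T : measurableType d) (R : realType) (P : probability T R).

Definition random_vector (V : hilbertType R) (X : T -> V) :=
  measurable_fun setT (X : T -> borelType V).

Definition history (V : hilbertType R) (x : nat -> T -> V) (n : nat) :
    set (set T) :=
  <<s \bigcup_(k in [set k | (k <= n)%N])
        preimage_set_system setT (x k) (borel V)>>.

(* sweep m is finite and carries its discrete sigma-algebra *)
Definition sigma_sweep m (e : T -> sweep m) : set (set T) :=
  preimage_set_system setT e setT.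

Definition independent (E G : set (set T)) :=
  forall A B, E A -> G B -> P (A `&` B) = (P A * P B)%E.

(* Z is a version of E(Y | G) for a nonnegative, possibly non-integrable Y;
   hence Z is extended-valued and characterised by its integrals over G *)
Definition is_cond_expectation (G : set (set T)) (Y Z : T -> \bar R) :=
  [/\ forall w, (0 <= Z w)%E,
      forall B : set (\bar R), measurable B -> G (Z @^-1` B) &
      forall A, G A -> (\int[P]_(w in A) Z w = \int[P]_(w in A) Y w)%E].

End probability_notions.

(* Main.v *)
Require Import Defs.
From HB Require Import structures.
From mathcomp Require Import all_boot all_order all_algebra.
From mathcomp Require Import all_classical all_reals all_analysis.
From mathcomp Require Import measurable_realfun ring lra.

Set Implicit Arguments.
Unset Strict Implicit.
Unset Printing Implicit Defensive.

Import Order.TTheory GRing.Theory Num.Theory.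
Import numFieldNormedType.Exports.

Local Open Scope classical_set_scope.
Local Open Scope ring_scope.

(** The proof measures distances in the norm whose square is the sum over the
    blocks of [(p i)^-1 * `|v i| ^+ 2]. Block [i] is updated with probability
    [p i], independently of the past, and its weight compensates this: in
    conditional expectation, a random sweep changes the squared weighted distance
    to a common fixed point [z] by the same amount as a full relaxed step changes
    the squared unweighted distance. By quasinonexpansiveness that amount is at
    most [- lambda n * (1 - lambda n) * `|T n x - x| ^+ 2] ([relaxed_step_le],
    [block_step_le]).

    The errors [a n] are absorbed multiplicatively. Young's inequality with a
    parameter [b n] that is determined by the past, almost surely summable over
    [n], and whose square dominates the conditional second moment of the error,
    shows that one plus the squared distance grows in conditional expectation by
    a factor [(1 + b n) ^+ 2] at most. Divided by the product of these factors it
    becomes a nonnegative supermartingale, which loses a multiple of the squared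
    displacement at each step ([energy_super]). The product stays bounded almost
    surely ([ae_damping_cvg]), so that the weighted distances to [z] converge
    almost surely ([ae_wnorm2_cvg]), and summability of the losses gives the convergence of [T n (x n) - x n] to zero
    ([ae_displacement_cvg0]).

    Conditional expectations are replaced throughout by inequalities between
    integrals over the events of a sigma-algebra ([cond_le]). These make sense
    for all nonnegative functions, and both the pull-out property
    ([cond_le_mul]) and Doob's upcrossing argument ([upcross_bounded],
    [supermartingale_cvg]) can be carried out with them.

    Finally, weak convergence is Opial's argument ([Opial]). Outside of a single
    null set the weighted distances to a dense sequence of points of [F]
    converge; bounded sequences have weak cluster points ([bounded_weak_subseq],
    which rests on [Riesz]); two weak cluster points in [F] coincide; and a
    strong cluster point forces the distance to the weak limit to vanish. The
    limit is a random variable because in a separable Hilbert space weakly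
    measurable maps are Borel ([weakly_measurable]). *)

(** * Inner products *)

Lemma natSinv_lt (R : realType) (e : R) : 0 < e ->
  exists N, forall n, (N <= n)%N -> n.+1%:R^-1 < e.
Proof.
move=> e0; have [N _ NP] := near_infty_natSinv_lt (PosNum e0).
by exists N => n /NP.
Qed.

Section inner_product.
Context (R : realType) (V : hilbertType R).
Implicit Types x y z : V.

Lemma innerDr x y z : inner x (y + z) = inner x y + inner x z.
Proof. by rewrite innerC innerDl !(innerC x). Qed.

Lemma innerZr k x y : inner x (k *: y) = k * inner x y.
Proof. by rewrite innerC innerZl innerC. Qed.

Lemma innerNl x y : inner (- x) y = - inner x y.
Proof. by rewrite -scaleN1r innerZl mulN1r. Qed.

Lemma innerBl x y z : inner (x - y) z = inner x z - inner y z.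
Proof. by rewrite innerDl innerNl. Qed.

Lemma innerBr x y z : inner x (y - z) = inner x y - inner x z.
Proof. by rewrite innerC innerBl !(innerC x). Qed.

Lemma inner0l x : inner 0 x = 0.
Proof. by rewrite -(scale0r x) innerZl mul0r. Qed.

Lemma normD_sqr x y : `|x + y| ^+ 2 = `|x| ^+ 2 + 2 * inner x y + `|y| ^+ 2.
Proof. by rewrite -!inner_normE innerDl !innerDr (innerC y x); ring. Qed.

Lemma normB_sqr x y : `|x - y| ^+ 2 = `|x| ^+ 2 - 2 * inner x y + `|y| ^+ 2.
Proof. by rewrite -!inner_normE innerBl !innerBr (innerC y x); ring. Qed.

Lemma inner_le_norm x y : inner x y <= `|x| * `|y|.
Proof.
have [->|y0] := eqVneq y 0; first by rewrite innerC inner0l normr0 mulr0.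
have ny0 : 0 < `|y| by rewrite normr_gt0.
have := sqr_ge0 `|(`|y|) *: x - `|x| *: y|.
rewrite normB_sqr innerZl innerZr !normrZ !normr_id => h.
have [->|x0] := eqVneq x 0; first by rewrite inner0l normr0 mul0r.
have nx0 : 0 < `|x| by rewrite normr_gt0.
have xy0 : 0 < `|x| * `|y| by rewrite mulr_gt0.
by rewrite -(ler_pM2l xy0); nra.
Qed.

Lemma CauchySchwarz x y : `|inner x y| <= `|x| * `|y|.
Proof.
by rewrite ler_norml inner_le_norm andbT lerNl -innerNl -(normrN x) inner_le_norm.
Qed.

(** Young's inequality on the cross term. With a free parameter [b] the bound is
    additive in the two squared norms, so that it can be integrated term by term,
    with [b] a random variable of the past, where the triangle inequality would
    ask for a conditional Cauchy-Schwarz inequality. *)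
Lemma normD_sqr_Young (b : R) x y : 0 < b ->
  `|x + y| ^+ 2 <= (1 + b) * `|x| ^+ 2 + (1 + b^-1) * `|y| ^+ 2.
Proof.
move=> b0; rewrite normD_sqr.
have := inner_le_norm x y; set c := inner x y; set p := `|x|; set q := `|y|.
move=> h; have qE : q = b * (q / b) by rewrite mulrC divfK// gt_eqF.
have -> : (1 + b^-1) * q ^+ 2 = q ^+ 2 + b * (q / b) ^+ 2.
  by field; rewrite gt_eqF.
suff : 2 * c <= b * p ^+ 2 + b * (q / b) ^+ 2 by nra.
have : 2 * (p * (b * (q / b))) <= b * p ^+ 2 + b * (q / b) ^+ 2.
  by have := mulr_ge0 (ltW b0) (sqr_ge0 (p - q / b)); nra.
by rewrite -qE; nra.
Qed.

Lemma norm_convex_comb_sqr (l : R) x y :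
  `|x + l *: (y - x)| ^+ 2 =
  (1 - l) * `|x| ^+ 2 + l * `|y| ^+ 2 - l * (1 - l) * `|y - x| ^+ 2.
Proof.
by rewrite normD_sqr innerZr innerBr normB_sqr normrZ exprMn
  real_normK ?num_real// normB_sqr inner_normE (innerC y x); ring.
Qed.

Lemma norm_le_inner_sup x (r : R) :
  (forall y, inner x y <= r * `|y|) -> 0 <= r -> `|x| <= r.
Proof.
move=> /(_ x); rewrite inner_normE => h r0.
have [->|x0] := eqVneq x 0; first by rewrite normr0.
by rewrite -(@ler_pM2r _ `|x|) ?normr_gt0// -expr2.
Qed.

Lemma cvg_inner (T : Type) (G : set_system T) (f : T -> V) l y : Filter G ->
  f @ G --> l -> inner (f t) y @[t --> G] --> inner l y.
Proof.
move=> FG fl; apply/cvgrPdist_lt => e e0.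
have d0 : 0 < e / (`|y| + 1) by rewrite divr_gt0// ltr_wpDl.
move/cvgrPdist_lt : fl => /(_ _ d0); apply: filterS => t.
rewrite ltr_pdivlMr ?ltr_wpDl// => lt.
rewrite -innerBl; apply: le_lt_trans (CauchySchwarz _ _) _.
by apply: le_lt_trans lt; rewrite ler_wpM2l// lerDl.
Qed.

Lemma strong_weakly_cvg (u : nat -> V) l : u @ \oo --> l -> weakly_cvg u l.
Proof. by move=> ul y; exact: cvg_inner. Qed.

(** The representative minimises [|y|^2 - 2 L y]: by the parallelogram identity
    minimising sequences are Cauchy, and the first-order condition at their
    limit is [L y = inner l y]. *)
Lemma Riesz (L : V -> R) (C : R) :
  (forall x y, L (x + y) = L x + L y) ->
  (forall k x, L (k *: x) = k * L x) ->
  (forall x, `|L x| <= C * `|x|) ->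
  exists l, forall y, L y = inner l y.
Proof.
move=> LD LZ LC; pose J y := `|y| ^+ 2 - 2 * L y.
have J_ge y : - C ^+ 2 <= J y.
  rewrite /J; have := ler_norm (L y); have := LC y.
  have := sqr_ge0 (`|y| - C); nra.
have J_inf : has_inf (range J).
  by split; [exists (J 0), 0|exists (- C ^+ 2) => _ [y _ <-]; exact: J_ge].
pose I := inf (range J).
have I_le y : I <= J y by apply: ge_inf; [exact: J_inf.2|exists y].
have /choice[u uI] : forall n, exists y, J y < I + n.+1%:R^-1.
  move=> n; have n0 : 0 < n.+1%:R^-1 :> R by rewrite invr_gt0.
  by have [_ [y _ <-]] := inf_adherent n0 J_inf; exists y.
have J_mid x y : `|x - y| ^+ 2 / 2 <= J x + J y - 2 * I.
  have := I_le (2^-1 *: (x + y)); rewrite /J LZ LD.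
  rewrite normrZ exprMn (normD_sqr x y) (normB_sqr x y) ger0_norm ?invr_ge0//.
  by rewrite expr2; lra.
have u_cauchy (e : R) : 0 < e ->
    exists N, forall i j, (N <= i)%N -> (N <= j)%N -> `|u i - u j| < e.
  move=> e0; have [|N NP] := @natSinv_lt R (e ^+ 2 / 4).
    by rewrite divr_gt0// exprn_gt0.
  exists N => i j Ni Nj; rewrite -ltr_sqr ?nnegrE ?(ltW e0)//.
  have := J_mid (u i) (u j); have := uI i; have := uI j.
  have := NP _ Ni; have := NP _ Nj.
  move: (J (u i)) (J (u j)) (i.+1%:R^-1) (j.+1%:R^-1) (`|_| ^+ 2) (I).
  by move=> a b c k f g; lra.
have u_cvg : cvgn u.
  apply: cauchy_cvg; apply/cauchy_ballP => e /u_cauchy[N NP].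
  exists (u @` [set n | (N <= n)%N], u @` [set n | (N <= n)%N]) => /=.
    by split; exists N => // n /= Nn; exists n.
  move=> [_ _] /= [[i Ni <-] [j Nj <-]]; rewrite -ball_normE /=.
  exact: NP.
pose l := limn u; exists l => y.
have ul : u n @[n --> \oo] --> l by [].
have J_min t : 0 <= 2 * t * (inner l y - L y) + t ^+ 2 * `|y| ^+ 2.
  have cl : 2 * t * (inner (u n) y - L y) + t ^+ 2 * `|y| ^+ 2 + n.+1%:R^-1
      @[n --> \oo] --> 2 * t * (inner l y - L y) + t ^+ 2 * `|y| ^+ 2 + 0.
    apply: cvgD; last exact: cvg_harmonic.
    apply: cvgD; last exact: cvg_cst.
    apply: cvgM; first exact: cvg_cst.
    by apply: cvgB; [exact: cvg_inner|exact: cvg_cst].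
  rewrite -[X in 0 <= X]addr0; apply: (cvgr_to_ge cl).
  near=> n; have := I_le (u n + t *: y); have := uI n.
  rewrite /J LD LZ normD_sqr innerZr normrZ exprMn real_normK ?num_real//.
  by move: (n.+1%:R^-1) => r; lra.
apply/eqP/negPn/negP => /eqP Ly; set s := inner l y - L y in J_min.
have s0 : s != 0 by rewrite subr_eq0 eq_sym; apply/eqP.
have [y0|y0] := eqVneq y 0.
  by apply: Ly; rewrite y0 innerC inner0l -(scale0r (0 : V)) LZ mul0r.
have ny0 : 0 < `|y| ^+ 2 by rewrite exprn_gt0// normr_gt0.
have := J_min (- s / `|y| ^+ 2); apply/negP; rewrite -ltNge.
rewrite [ltLHS](_ : _ = - (s ^+ 2 / `|y| ^+ 2)).
  by rewrite oppr_lt0 divr_gt0// lt_neqAle sqr_ge0 eq_sym sqrf_eq0 s0.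
by field; rewrite gt_eqF// normr_gt0.
Unshelve. all: by end_near. Qed.

End inner_product.

(** * Dense sequences and weak sequential compactness *)

Section separability.
Context (R : realType) (V : hilbertType R).

(** Points of the dense set need not lie in [F]: for each of them and each radius
    [1 / (k + 1)], a point of [F] in the corresponding ball is chosen if there is
    one. *)
Lemma separable_subset_seq (F : set V) : separable V -> F !=set0 ->
  exists z : nat -> V, (forall n, F (z n)) /\
    forall x e, F x -> 0 < e -> exists n, `|x - z n| < e.
Proof.
move=> [A /countable_injP[f finj] dA] [z0 Fz0].
have /choice[y yP] : forall p : nat * nat, exists y, F y /\
    forall q y', A q -> f q = p.1 -> F y' -> `|y' - q| < p.2.+1%:R^-1 ->
      `|y - q| < p.2.+1%:R^-1.
  move=> p; have [[q [y' [Aq fq Fy' y'q]]]|np] := pselect (exists q y',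
      [/\ A q, f q = p.1, F y' & `|y' - q| < p.2.+1%:R^-1]).
    exists y'; split => // r y'' Ar fr Fy'' _.
    by rewrite (finj r q) ?inE// fq.
  by exists z0; split => // q y' Aq fq Fy' y'q; case: np; exists q, y'.
pose z n := if unpickle n is Some p then y p else z0.
exists z; split => [n|x e Fx e0].
  by rewrite /z; case: unpickle => // p; case: (yP p).
have [|N /(_ N (leqnn N)) Ne] := @natSinv_lt R (e / 2); first by rewrite divr_gt0.
have N0 : 0 < N.+1%:R^-1 :> R by rewrite invr_gt0.
have [||q [qx Aq]] := dA (ball x N.+1%:R^-1); last 1 first.
- exists (pickle (f q, N)); rewrite /z pickleK.
  rewrite -ball_normE /= in qx.
  have yq := (yP (f q, N)).2 q x Aq erefl Fx qx.
  rewrite (_ : _ - _ = (x - q) - (y (f q, N) - q)); last first.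
    by rewrite opprB addrA subrK.
  rewrite (le_lt_trans (ler_normB _ _))// [ltRHS]splitr ltrD//.
    exact: lt_trans qx Ne.
  exact: lt_trans yq Ne.
- by exists x; exact: ballxx.
- exact: ball_open.
Qed.

Lemma separable_seq : separable V ->
  exists q : nat -> V, forall x e, 0 < e -> exists n, `|x - q n| < e.
Proof.
move=> sV; have [//|q [_ qP]] := @separable_subset_seq setT sV.
  by exists 0.
by exists q => x e; exact: qP.
Qed.

End separability.

Section weak_compactness.
Context (R : realType).

Lemma ultra_fmap (T U : Type) (f : T -> U) (F : set_system T) :
  UltraFilter F -> UltraFilter (f @ F).
Proof.
move=> FU; split=> [|G PG FG]; first exact: fmap_proper_filter.
apply/seteqP; split => // A GA.
have [//|FA] := in_ultra_setVsetC (f @^-1` A) FU.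
have : G (A `&` ~` A) by apply: filterI => //; exact: FG.
by rewrite setICr => /filter_not_empty.
Qed.

Lemma ultra_bounded_cvg (T : Type) (F : set_system T) (f : T -> R) (C : R) :
  UltraFilter F -> (forall t, `|f t| <= C) -> exists r : R, f @ F --> r.
Proof.
move=> FU fC; have := @segment_compact R (- C) C; rewrite compact_ultra.
move=> /(_ _ (ultra_fmap f FU))[|r [_ fr]]; last by exists r.
by apply: (@filterE _ F) => t /=; rewrite in_itv /= -ler_norml.
Qed.

Lemma subseq_exists (S : nat -> nat -> Prop) :
  (forall j N, exists2 n, (N < n)%N & S j n) ->
  exists2 k : nat -> nat, {homo k : i j / (i < j)%N} & forall j, S j (k j).
Proof.
move=> SP; have /choice[f fP] : forall p : nat * nat,
    exists n, (p.2 < n)%N /\ S p.1 n.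
  by move=> [j N]; have [n ? ?] := SP j N; exists n.
pose k := fix k j := if j is i.+1 then f (i.+1, k i) else f (0%N, 0%N).
exists k; last by case=> [|j]; [case: (fP (0%N, 0%N))|case: (fP (j.+1, k j))].
apply: homo_ltn => [|j]; first exact: ltn_trans.
by case: (fP (j.+1, k j)).
Qed.

Lemma subseq_cvgy (k : nat -> nat) : {homo k : i j / (i < j)%N} ->
  k j @[j --> \oo] --> \oo.
Proof.
move=> kmono; have k_ge j : (j <= k j)%N.
  by elim: j => // j ih; exact: leq_ltn_trans ih (kmono _ _ (ltnSn j)).
move=> A [N _ NA]; exists N => // j /= Nj.
by apply: NA; exact: leq_trans (k_ge j).
Qed.

Context (V : hilbertType R).
Implicit Types (u : nat -> V) (l : V).

Lemma weakly_cvg_dense u l (C : R) (q : nat -> V) :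
  (forall x e, 0 < e -> exists n, `|x - q n| < e) ->
  (forall n, `|u n| <= C) ->
  (forall i, inner (u n) (q i) @[n --> \oo] --> inner l (q i)) ->
  weakly_cvg u l.
Proof.
move=> qd uC uq y; apply/cvgrPdist_lt => e e0.
have C0 : 0 < C + `|l| + 1.
  by rewrite ltr_wpDl// addr_ge0// (le_trans _ (uC 0%N)).
have [|i yi] := qd y (e / 2 / (C + `|l| + 1)); first by rewrite !divr_gt0.
have e20 : 0 < e / 2 by rewrite divr_gt0.
move/cvgrPdist_lt : (uq i) => /(_ _ e20); apply: filterS => n lu.
rewrite -innerBl -(subrK (q i) y) innerDr.
rewrite (le_lt_trans (ler_normD _ _))// [ltRHS]splitr ltr_leD ?innerBl//.
  rewrite -innerBl (le_lt_trans (CauchySchwarz _ _))//.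
  move: yi; rewrite ltr_pdivlMr// mulrC; apply: le_lt_trans.
  rewrite ler_wpM2r// (le_trans (ler_normB _ _))//.
  by rewrite addrC -addrA lerD// lerDl.
exact: ltW.
Qed.

(** Along an ultrafilter finer than [\oo] all the bounded real sequences
    [inner (u n) y] converge at once; the limits form a bounded linear
    functional of [y], and its representative is approached along a
    subsequence that takes care of one more dense direction at each step. *)
Lemma bounded_weak_subseq u (C : R) : separable V -> (forall n, `|u n| <= C) ->
  weak_cluster u !=set0.
Proof.
move=> /separable_seq[q qd] uC.
have [U [UU sU]] := @ultraFilterLemma nat \oo _.
have C0 : 0 <= C by rewrite (le_trans _ (uC 0%N)).
have uy y n : `|inner (u n) y| <= C * `|y|.
  by rewrite (le_trans (CauchySchwarz _ _))// ler_wpM2r.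
have /choice[L LP] : forall y, exists r : R, inner (u n) y @[n --> U] --> r.
  by move=> y; exact: (ultra_bounded_cvg UU (uy y)).
have Llim y r : inner (u n) y @[n --> U] --> r -> L y = r.
  by move=> yr; exact: (cvg_unique _ (LP y) yr).
have [||y|l lP] := @Riesz R V L C.
- move=> y y'; apply: Llim; under eq_fun do rewrite innerDr.
  by apply: cvgD; exact: LP.
- move=> k y; apply: Llim; under eq_fun do rewrite innerZr.
  by apply: cvgM; [exact: cvg_cst|exact: LP].
- rewrite ler_norml; apply/andP; split.
    apply: (cvgr_to_ge (LP y)); apply: filterE => n.
    by have := uy y n; rewrite ler_norml => /andP[].
  apply: (cvgr_to_le (LP y)); apply: filterE => n.
  by have := uy y n; rewrite ler_norml => /andP[].
have [j N|k kmono kP] := @subseq_exists (fun j n => forall i, (i <= j)%N ->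
    `|inner l (q i) - inner (u n) (q i)| < j.+1%:R^-1).
  have : \forall n \near U, forall i : 'I_j.+1,
      `|inner l (q i) - inner (u n) (q i)| < j.+1%:R^-1.
    apply: filter_forall => i; rewrite -lP.
    by move/cvgrPdist_lt : (LP (q i)); apply; rewrite invr_gt0.
  move=> /(filterI (sU _ (nbhs_infty_gt N)))/filter_ex[n [Nn nP]].
  by exists n => // i ij; exact: (nP (Ordinal (ij : (i < j.+1)%N))).
exists l; exists k => //; apply: (weakly_cvg_dense (C := C) qd) => [n|i].
  exact: uC.
apply/cvgrPdist_lt => e /natSinv_lt[N NP]; exists (maxn i N) => // n /=.
rewrite geq_max => /andP[ni nN].
exact: lt_trans (kP n i ni) (NP n nN).
Qed.

Lemma weak_cluster_subseq u (k : nat -> nat) : {homo k : i j / (i < j)%N} ->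
  weak_cluster (u \o k) `<=` weak_cluster u.
Proof.
by move=> kmono l [k' k'mono kl]; exists (k \o k') => // i j /k'mono/kmono.
Qed.

(** A subsequence that stays away from [l] in some direction would have a weak
    cluster point different from [l]. *)
Lemma unique_weak_cluster_cvg u (C : R) : separable V ->
  (forall n, `|u n| <= C) ->
  (forall l l', weak_cluster u l -> weak_cluster u l' -> l = l') ->
  exists2 l, weak_cluster u l & weakly_cvg u l.
Proof.
move=> sV uC uniq_cl; have [l ul] := bounded_weak_subseq sV uC.
exists l => // y; apply/cvgrPdist_lt => e e0; apply: contrapT => nl.
have [j N|k kmono kP] := @subseq_exists (fun _ n =>
    e <= `|inner l y - inner (u n) y|).
  apply: contrapT => nN; apply: nl; exists N.+1 => // n /= Nn.
  by rewrite ltNge; apply/negP => en; apply: nN; exists n.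
have [l' ukl'] := @bounded_weak_subseq (u \o k) C sV (fun=> uC _).
have l'l := uniq_cl _ _ (weak_cluster_subseq kmono ukl') ul.
case: ukl' => k' _; rewrite l'l => /(_ y)/cvgrPdist_lt/(_ e e0)[N _ NP].
by have := NP N (leqnn N); rewrite /= ltNge kP.
Qed.

End weak_compactness.

(** * Domination of conditional expectations *)

Section conditional_domination.
Context d (T : measurableType d) (R : realType) (P : probability T R).
Implicit Types (f g h : T -> R).

(** For a nonnegative [f], the inequality E(f | G) <= E(g | G) with all
    conditional expectations eliminated; it makes sense without integrability. *)
Definition cond_le (G : set (set T)) f g := forall A, <<s G >> A ->
  (\int[P]_(w in A) (f w)%:E <= \int[P]_(w in A) (g w)%:E)%E.

Definition nnmeasurable f := measurable_fun setT f /\ forall w, 0 <= f w.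

Definition adapted (G : set (set T)) f :=
  measurable_fun setT (f : g_sigma_algebraType G -> R).

Context (G : set (set T)) (sG : <<s G >> `<=` measurable).

Lemma adapted_measurable f : adapted G f -> measurable_fun setT f.
Proof. by move=> mf _ B mB; apply: sG; exact: mf. Qed.

Lemma adapted_nnmeasurable f : adapted G f -> (forall w, 0 <= f w) ->
  nnmeasurable f.
Proof. by move=> mf f0; split => //; exact: adapted_measurable. Qed.

Lemma nnmeasurableD f g : nnmeasurable f -> nnmeasurable g ->
  nnmeasurable (f \+ g).
Proof.
move=> [mf f0] [mg g0]; split; first exact: measurable_funD.
by move=> w; rewrite addr_ge0.
Qed.

Lemma nnmeasurableM f g : nnmeasurable f -> nnmeasurable g ->
  nnmeasurable (fun w => f w * g w).
Proof.
move=> [mf f0] [mg g0]; split; first exact: measurable_funM.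
by move=> w; rewrite mulr_ge0.
Qed.

Lemma nnmeasurable_indic (A : set T) : measurable A ->
  nnmeasurable (\1_A : T -> R).
Proof. by move=> mA; split => [|w]; [exact: measurable_indic|rewrite indicE]. Qed.

Lemma nnmeasurable_cst (k : R) : 0 <= k -> nnmeasurable (cst k).
Proof. by move=> k0; split. Qed.

Import HBNNSimple.

Lemma integral_nnsfun_mul (s : {nnsfun (g_sigma_algebraType G) >-> R}) f A :
  nnmeasurable f -> <<s G >> A ->
  (\int[P]_(w in A) (s w * f w)%:E =
   \sum_(r \in range s) r%:E * \int[P]_(w in A `&` s @^-1` [set r]) (f w)%:E)%E.
Proof.
move=> [mf f0] GA; have mA := sG GA.
have ms r : measurable (s @^-1` [set r] : set T).
  by apply: sG; exact: (measurable_funPTI s).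
under eq_integral => w _.
  rewrite fimfunE fsbig_finite//= mulr_suml -sumEFin.
  over.
rewrite /= ge0_integral_sum//; last 2 first.
- move=> r; apply/measurable_EFinP; apply: measurable_funTS.
  by apply: measurable_funM => //; apply: measurable_funM => //;
    exact: measurable_indic.
- move=> r w _; rewrite lee_fin mulr_ge0//.
  rewrite indicE; case: (boolP (w \in _)) => [|_]; last by rewrite mulr0.
  by rewrite inE /= => <-; rewrite mulr1.
rewrite [RHS]fsbig_finite//=; apply: eq_big_seq => r.
rewrite in_fset_set// inE => -[w0 _ <-].
rewrite integral_mkcondr -ge0_integralZl_EFin//.
- by apply: eq_integral => w _; rewrite patchE indicE; case: ifPn;
    rewrite ?(mulr1, mulr0, mul0r, mule0)// EFinM.
- by move=> w _; rewrite patchE; case: ifPn => // _; rewrite lee_fin.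
- apply/measurable_restrict => //.
  by apply: measurable_funTS; exact/measurable_EFinP.
Qed.

(** Only indicators of events of [<<s G>>] are tested in the definition of
    [cond_le]; simple functions and monotone limits extend it to all nonnegative
    <<s G>>-measurable weights. This is the pull-out property of conditional
    expectations, in the one direction that supermartingale estimates use. *)
Lemma cond_le_mul f g h : nnmeasurable f -> nnmeasurable g ->
  adapted G h -> (forall w, 0 <= h w) -> cond_le G f g ->
  cond_le G (fun w => h w * f w) (fun w => h w * g w).
Proof.
move=> mf mg ah h0 fg A GA; have mA := sG GA; have mh := adapted_measurable ah.
have mh' : measurable_fun [set: g_sigma_algebraType G] (EFin \o h).
  exact/measurable_EFinP.
pose s := nnsfun_approx measurableT mh'.
have s_h w : s k w @[k --> \oo] --> h w.
  have /fine_cvgP[_] := cvg_nnsfun_approx measurableT mh' (fun w _ => h0 w)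
    (I : [set: g_sigma_algebraType G] w).
  exact.
have s_nd m n w : (m <= n)%N -> s m w <= s n w.
  by move=> mn; have /lefP := nd_nnsfun_approx measurableT mh' mn; exact.
have mS k : measurable_fun setT (s k : T -> R).
  by apply: adapted_measurable; exact: measurable_funP.
have sh k w : s k w <= h w.
  apply: (cvgr_to_ge (s_h w)); exists k => // n /= kn.
  exact: s_nd.
have -> : (\int[P]_(w in A) (h w * f w)%:E =
    limn (fun k => \int[P]_(w in A) (s k w * f w)%:E))%E.
  rewrite -monotone_convergence//.
  - apply: eq_integral => w _; apply/esym/cvg_lim => //.
    apply: cvg_EFin; first exact: nearW.
    by apply: cvgM; [exact: s_h|exact: cvg_cst].
  - move=> k; apply/measurable_EFinP; apply: measurable_funTS.
    by apply: measurable_funM => //; exact: mf.1.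
  - by move=> k w _; rewrite lee_fin mulr_ge0// mf.2.
  - by move=> w _ m n mn; rewrite lee_fin ler_wpM2r ?mf.2// s_nd.
apply: lime_le.
  apply: ereal_nondecreasing_is_cvgn => m n mn.
  apply: ge0_le_integral => //.
  - by move=> w _; rewrite lee_fin mulr_ge0// mf.2.
  - apply/measurable_EFinP; apply: measurable_funTS.
    by apply: measurable_funM => //; exact: mf.1.
  - apply/measurable_EFinP; apply: measurable_funTS.
    by apply: measurable_funM => //; exact: mf.1.
  - by move=> w _; rewrite lee_fin ler_wpM2r ?mf.2// s_nd.
apply: nearW => k.
apply: (@le_trans _ _ (\int[P]_(w in A) (s k w * g w)%:E)%E); last first.
  apply: ge0_le_integral => //.
  - by move=> w _; rewrite lee_fin mulr_ge0// mg.2.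
  - apply/measurable_EFinP; apply: measurable_funTS.
    by apply: measurable_funM => //; exact: mg.1.
  - apply/measurable_EFinP; apply: measurable_funTS.
    by apply: measurable_funM => //; exact: mg.1.
  - by move=> w _; rewrite lee_fin ler_wpM2r ?mg.2// sh.
rewrite !integral_nnsfun_mul//.
apply: lee_fsum => // r [w _ <-].
rewrite lee_wpmul2l ?lee_fin//; apply: fg.
exact: (@measurableI _ (g_sigma_algebraType G)).
Qed.

Lemma cond_le_refl f : cond_le G f f.
Proof. by move=> A _. Qed.

Lemma cond_le_trans f g h : cond_le G f g -> cond_le G g h -> cond_le G f h.
Proof. by move=> fg gh A GA; exact: le_trans (fg _ GA) (gh _ GA). Qed.

Lemma cond_le_add f g f' g' : nnmeasurable f -> nnmeasurable g ->
  nnmeasurable f' -> nnmeasurable g' -> cond_le G f g -> cond_le G f' g' ->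
  cond_le G (f \+ f') (g \+ g').
Proof.
move=> [mf f0] [mg g0] [mf' f'0] [mg' g'0] fg fg' A GA; have mA := sG GA.
under eq_integral do rewrite EFinD.
under [leRHS]eq_integral do rewrite EFinD.
rewrite !ge0_integralD//; try (by move=> w _; rewrite lee_fin);
  try (by apply/measurable_EFinP; exact: measurable_funTS).
by apply: leeD; [exact: fg|exact: fg'].
Qed.

Lemma nnmeasurable_sum (I : Type) (r : seq I) (F : I -> T -> R) :
  (forall i, nnmeasurable (F i)) -> nnmeasurable (fun w => \sum_(i <- r) F i w).
Proof.
move=> mF; split; last by move=> w; rewrite sumr_ge0// => i _; exact: (mF i).2.
by apply: measurable_sum => i; exact: (mF i).1.
Qed.

Lemma cond_le_sum (I : Type) (r : seq I) (F F' : I -> T -> R) :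
  (forall i, nnmeasurable (F i)) -> (forall i, nnmeasurable (F' i)) ->
  (forall i, cond_le G (F i) (F' i)) ->
  cond_le G (fun w => \sum_(i <- r) F i w) (fun w => \sum_(i <- r) F' i w).
Proof.
move=> mF mF' FF'; elim: r => [|i r ih].
  suff -> : (fun w => \sum_(i <- [::]) F i w) = fun w => \sum_(i <- [::]) F' i w.
    exact: cond_le_refl.
  by apply/funext => w; rewrite !big_nil.
have consE (E : I -> T -> R) : (fun w => \sum_(j <- i :: r) E j w) =
    E i \+ (fun w => \sum_(j <- r) E j w).
  by apply/funext => w; rewrite big_cons.
by rewrite !consE; apply: cond_le_add => //; exact: nnmeasurable_sum.
Qed.

Lemma ae_cond_le f g : nnmeasurable f -> nnmeasurable g ->
  {ae P, forall w, f w <= g w} -> cond_le G f g.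
Proof.
move=> [mf f0] [mg g0] fg A GA; have mA := sG GA.
apply: ae_ge0_le_integral => //.
- by move=> w _; rewrite lee_fin.
- by apply/measurable_EFinP; exact: measurable_funTS.
- by move=> w _; rewrite lee_fin.
- by apply/measurable_EFinP; exact: measurable_funTS.
- by apply: filterS fg => w fgw _; rewrite lee_fin.
Qed.

Lemma le_cond_le f g : nnmeasurable f -> nnmeasurable g ->
  (forall w, f w <= g w) -> cond_le G f g.
Proof. by move=> mf mg fg; apply: ae_cond_le => //; exact: aeW. Qed.

End conditional_domination.

(** * Upcrossings *)

Section real_crossings.
Context (R : realType).
Implicit Types u : nat -> R.

Definition infinitely_often (Q : nat -> Prop) :=
  forall N, exists2 n, (N <= n)%N & Q n.

Definition crosses u (a b : R) :=
  infinitely_often (fun n => u n <= a) /\ infinitely_often (fun n => b <= u n).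

Lemma not_infinitely_often (Q : nat -> Prop) : ~ infinitely_often Q ->
  exists N, forall n, (N <= n)%N -> ~ Q n.
Proof.
move=> nQ; apply: contrapT => nN; apply: nQ => N; apply: contrapT => nn.
by apply: nN; exists N => n Nn Qn; apply: nn; exists n.
Qed.

(** The limit is the supremum of the eventual lower bounds: a number above it is
    separated from it by two rational levels, and [u], which is infinitely often
    below the lower level, is eventually below the upper one. *)
Lemma crossing_free_cvg u (B : R) : (forall n, 0 <= u n) ->
  infinitely_often (fun n => u n <= B) ->
  (forall a b : rat, 0 <= (ratr a : R) < ratr b ->
     ~ crosses u (ratr a) (ratr b)) ->
  cvgn u.
Proof.
move=> u0 uB ncross.
have low (a b : R) : 0 <= a < b -> infinitely_often (fun n => u n <= a) ->
    exists N, forall n, (N <= n)%N -> u n < b.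
  move=> /andP[a0 ab] ua.
  have [p /itvP pab] := rat_in_itvoo ab.
  have pb : ratr p < b by rewrite pab.
  have [q /itvP qpb] := rat_in_itvoo pb.
  have [|N NP] := @not_infinitely_often (fun n => ratr q <= u n).
    move=> uq; apply: (ncross p q); first by rewrite qpb (le_trans a0) ?pab.
    split => // N; have [n Nn una] := ua N; exists n => //.
    by rewrite (le_trans una) ?pab.
  exists N => n /NP/negP; rewrite -ltNge => /lt_trans; apply.
  by rewrite qpb.
pose S := [set r : R | exists N, forall n, (N <= n)%N -> r <= u n].
have S0 : S 0 by exists 0%N => n _; exact: u0.
have B0 : 0 <= B by have [n _] := uB 0%N; apply: le_trans.
have S_sup : has_sup S.
  split; first by exists 0.
  exists B => r [N NP]; have [n Nn unB] := uB N.
  by rewrite (le_trans _ unB)// NP.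
have L0 : 0 <= sup S by apply: sup_upper_bound.
apply/cvg_ex; exists (sup S); apply/cvgrPdist_lt => e e0.
have [s [M MP] sL] := sup_adherent e0 S_sup.
have [||N NP] := low (sup S + e / 2) (sup S + e).
- rewrite ltrD2l ltr_pdivrMr// mulr_natr mulr2n ltrDl e0 andbT.
  by rewrite addr_ge0// ltW// divr_gt0.
- apply: contrapT => /not_infinitely_often[N NP].
  have : S (sup S + e / 2).
    by exists N => n /NP/negP; rewrite -ltNge => /ltW.
  move=> /(sup_upper_bound S_sup); rewrite gerDl leNgt divr_gt0//.
exists (maxn M N) => // n; rewrite /= geq_max => /andP[/MP sn /NP nL].
by rewrite ltr_norml; apply/andP; split; move: (sup S) sL sn nL => L; lra.
Qed.

Lemma not_cvgy_infinitely_often u : (limn_einf (EFin \o u) < +oo)%E ->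
  exists B, infinitely_often (fun n => u n <= B).
Proof.
move=> uoo; apply: contrapT => nB; move: uoo.
suff /cvg_limn_einf_sup[-> _] : (EFin \o u) n @[n --> \oo] --> (+oo)%E by [].
apply/cvgeyPgt => A; have [N NP] : exists N, forall n, (N <= n)%N -> ~ (u n <= A).
  by apply: not_infinitely_often => uA; apply: nB; exists A.
by exists N => // n /NP/negP; rewrite -ltNge /= lte_fin.
Qed.

End real_crossings.

Section upcrossings.
Context d (T : measurableType d) (R : realType) (P : probability T R).
Context (G : nat -> set (set T)) (sG : forall n, <<s G n >> `<=` measurable).
Context (mono : forall n, <<s G n >> `<=` <<s G n.+1 >>).
Context (W : nat -> T -> R) (W_adapted : forall n, adapted (G n) (W n)).
Context (W_ge0 : forall n w, 0 <= W n w).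
Context (W_super : forall n, cond_le P (G n) (W n.+1) (W n)).
Context (a b : R) (a0 : 0 <= a) (ab : a < b).

(** Doob's investor buys when the price [W] is at most [a] and sells when it is at
    least [b]; [holding n] is the event that the asset is owned after time [n]. *)
Fixpoint holding n : set T := if n is k.+1 then
    (holding k `&` [set w | W k.+1 w < b]) `|`
    (~` holding k `&` [set w | W k.+1 w <= a])
  else [set w | W 0%N w <= a].

Let sale k : set T := holding k `&` [set w | b <= W k.+1 w].

Definition upcross n w : R := \sum_(k < n) \1_(sale k) w.

(** An owner counts the asset at its current price and a non-owner has [a] in
    cash: buying can then only lower the wealth, and selling raises the first
    term by what the second one loses or less. This makes wealth a nonnegative
    supermartingale even when [W] is not integrable, since the price enters
    after a purchase only. *)
Definition wealth n w : R := (b - a) * upcross n w +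
  (\1_(holding n) w * W n w + \1_(~` holding n) w * a).

Let sub_le n (Q : set R) : measurable Q -> <<s G n >> (W n @^-1` Q).
Proof. by move=> mQ; rewrite -[_ @^-1` _]setTI; exact: W_adapted. Qed.

Lemma holding_adapted n : <<s G n >> (holding n).
Proof.
elim: n => [|n ih].
  have -> : holding 0 = W 0%N @^-1` `]-oo, a].
    by apply/seteqP; split => w /=; rewrite in_itv.
  exact: sub_le.
pose Gn := g_sigma_algebraType (G n.+1).
apply: (@measurableU _ Gn); apply: (@measurableI _ Gn).
- exact: mono.
- rewrite (_ : [set w | _] = W n.+1 @^-1` `]-oo, b[); first exact: sub_le.
  by apply/seteqP; split => w /=; rewrite in_itv.
- by apply: (@measurableC _ Gn); exact: mono.
- rewrite (_ : [set w | _] = W n.+1 @^-1` `]-oo, a]); first exact: sub_le.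
  by apply/seteqP; split => w /=; rewrite in_itv.
Qed.

Let mH n : measurable (holding n).
Proof. by apply: sG; exact: holding_adapted. Qed.

Let mW n : measurable_fun setT (W n).
Proof. exact: (adapted_measurable (@sG n)). Qed.

Let msale k : measurable (sale k).
Proof.
apply: measurableI => //; rewrite -[X in measurable X]setTI.
rewrite (_ : [set w | _] = W k.+1 @^-1` `[b, +oo[); first exact: mW.
by apply/seteqP; split => w /=; rewrite in_itv /= andbT.
Qed.

Let upcross_ge0 n w : 0 <= upcross n w.
Proof. by apply: sumr_ge0 => k _; rewrite indicE. Qed.

Let mupcross n : measurable_fun setT (upcross n).
Proof. by apply: measurable_sum => k; exact: measurable_indic. Qed.

Let mstep n (V : T -> R) : measurable_fun setT V ->
  measurable_fun setT (fun w => \1_(holding n) w * V w).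
Proof. by move=> mV; apply: measurable_funM => //; exact: measurable_indic. Qed.

Let cash n w : R := (b - a) * upcross n w + \1_(~` holding n) w * a.

Let mcash n : measurable_fun setT (cash n).
Proof.
apply: measurable_funD; first exact: measurable_funM.
apply: measurable_funM => //; apply: measurable_indic.
exact: measurableC.
Qed.

Let cash_ge0 n w : 0 <= cash n w.
Proof.
by rewrite addr_ge0// mulr_ge0// ?upcross_ge0 ?indicE// subr_ge0 ltW.
Qed.

Lemma wealth_step n w :
  wealth n.+1 w <= cash n w + \1_(holding n) w * W n.+1 w.
Proof.
have -> : wealth n.+1 w = (b - a) * (upcross n w + \1_(sale n) w) +
    (\1_(holding n.+1) w * W n.+1 w + \1_(~` holding n.+1) w * a).
  by rewrite /wealth {1}/upcross big_ord_recr.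
rewrite /cash !indicE; move: (upcross n w) => S.
have [Hw|nHw] := pselect (holding n w).
- have [bW|Wb] := leP b (W n.+1 w).
  + rewrite !(@mem_set _ (sale n) w)// (@memNset _ (_ `|` _)); last first.
      by move=> [[_ /=]|[]//]; rewrite ltNge bW.
    rewrite mem_set; last by move=> [[_ /=]|[]//]; rewrite ltNge bW.
    rewrite (@memNset _ (~` _))// (@mem_set _ (holding n))//=; lra.
  + rewrite (@memNset _ (sale n)); last by move=> [_ /=]; rewrite leNgt Wb.
    rewrite (@mem_set _ (_ `|` _)); last by left.
    rewrite (@memNset _ (~` (_ `|` _))); last by move=> /=; apply; left.
    by rewrite (@memNset _ (~` _))// (@mem_set _ (holding n))//=; lra.
- rewrite (@memNset _ (sale n)); last by move=> [].
  rewrite (@memNset _ (holding n))// (@mem_set _ (~` holding n))//.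
  have [Wa|aW] := leP (W n.+1 w) a.
  + rewrite (@mem_set _ (_ `|` _)); last by right.
    by rewrite (@memNset _ (~` (_ `|` _)))/=; [lra|move=> /=; apply; right].
  + rewrite (@memNset _ (_ `|` _)); last first.
      by move=> [[]//|[_ /=]]; rewrite leNgt aW.
    rewrite mem_set /=; first lra.
    by move=> [[]//|[_ /=]]; rewrite leNgt aW.
Qed.

Let int_holding n (V : T -> R) : measurable_fun setT V ->
  (\int[P]_w (\1_(holding n) w * V w)%:E = \int[P]_(w in holding n) (V w)%:E)%E.
Proof.
move=> mV; rewrite [RHS]integral_mkcond; apply: eq_integral => w _.
by rewrite patchE indicE; case: ifPn; rewrite ?mul1r ?mul0r.
Qed.

Let wealthE n w : wealth n w = cash n w + \1_(holding n) w * W n w.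
Proof. by rewrite /wealth /cash addrA addrAC. Qed.

Lemma integral_wealth n : (\int[P]_w (wealth n w)%:E <= a%:E)%E.
Proof.
have int2 k (V : T -> R) : measurable_fun setT V -> (forall w, 0 <= V w) ->
    (\int[P]_w (cash k w + \1_(holding k) w * V w)%:E =
     \int[P]_w (cash k w)%:E + \int[P]_(w in holding k) (V w)%:E)%E.
  move=> mV V0; rewrite -int_holding//.
  under eq_integral do rewrite EFinD.
  rewrite ge0_integralD//.
  - by move=> w _; rewrite lee_fin.
  - by apply/measurable_EFinP.
  - by move=> w _; rewrite lee_fin mulr_ge0// indicE.
  - by apply/measurable_EFinP; exact: mstep.
have mwealth k : measurable_fun setT (wealth k).
  rewrite (_ : wealth k = fun w => cash k w + \1_(holding k) w * W k w).
    by apply: measurable_funD => //; exact: mstep.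
  by apply/funext => w; exact: wealthE.
have wealth_ge0 k w : 0 <= wealth k w.
  by rewrite wealthE addr_ge0// mulr_ge0// indicE.
elim: n => [|n ih].
  apply: (@le_trans _ _ (\int[P]_w (cst a%:E w))%E); last first.
    by rewrite integral_cst// [X in (_ * X)%E](probability_setT P) mule1.
  apply: ge0_le_integral => //.
  - by move=> w _; rewrite lee_fin.
  - exact/measurable_EFinP.
  - move=> w _; rewrite lee_fin /wealth /upcross big_ord0 mulr0 add0r !indicE.
    rewrite in_setC; case: (boolP (w \in _)) => [|_]; last first.
      by rewrite mul0r add0r mul1r.
    by rewrite inE /= mul1r mul0r addr0.
apply: le_trans ih.
apply: (@le_trans _ _
    (\int[P]_w (cash n w + \1_(holding n) w * W n.+1 w)%:E)%E).
  apply: ge0_le_integral => //.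
  - by move=> w _; rewrite lee_fin.
  - exact/measurable_EFinP.
  - by apply/measurable_EFinP; apply: measurable_funD => //; exact: mstep.
  - by move=> w _; rewrite lee_fin wealth_step.
under [leRHS]eq_integral do rewrite wealthE.
by rewrite !int2// leeD2l//; apply: W_super; exact: holding_adapted.
Qed.

(** Wealth is at least [(b - a)] times the number of upcrossings, so that the
    expected number of upcrossings is finite. *)
Lemma upcross_bounded : {ae P, forall w, exists C, forall n, upcross n w <= C}.
Proof.
have ba0 : 0 < b - a by rewrite subr_gt0.
have nd w : {homo (fun n => (upcross n w)%:E) : m n / (m <= n)%N >-> (m <= n)%E}.
  move=> m n mn; rewrite lee_fin /upcross.
  rewrite -!(big_mkord xpredT (fun k => \1_(sale k) w)).
  by rewrite (big_cat_nat (leq0n _) mn)//= lerDl sumr_ge0.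
pose U w := limn (fun n => (upcross n w)%:E).
have mU : measurable_fun setT U.
  apply: (emeasurable_fun_cvg (fun n w => (upcross n w)%:E)).
    by move=> n; exact/measurable_EFinP.
  by move=> w _; exact: ereal_nondecreasing_is_cvgn.
have U0 w : (0 <= U w)%E.
  apply: lime_ge; first exact: ereal_nondecreasing_is_cvgn.
  by apply: nearW => n; rewrite lee_fin.
have intU : (\int[P]_w U w <= (a / (b - a))%:E)%E.
  rewrite monotone_convergence//; last 2 first.
  - by move=> n; exact/measurable_EFinP.
  - by move=> n w _; rewrite lee_fin.
  apply: lime_le.
    apply: ereal_nondecreasing_is_cvgn => m n mn.
    apply: ge0_le_integral => //.
    - by move=> w _; rewrite lee_fin.
    - exact/measurable_EFinP.
    - exact/measurable_EFinP.
    - by move=> w _; exact: nd.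
  apply: nearW => n.
  rewrite -(@lee_pmul2l _ (b - a)%:E)// -EFinM mulrC divfK ?gt_eqF//.
  rewrite -ge0_integralZl_EFin//; last 3 first.
  - by move=> w _; rewrite lee_fin.
  - exact/measurable_EFinP.
  - exact: ltW.
  apply: le_trans (integral_wealth n).
  apply: ge0_le_integral => //.
  - by move=> w _; rewrite mule_ge0 ?lee_fin// ltW.
  - by apply: measurable_funeM; exact/measurable_EFinP.
  - apply/measurable_EFinP.
    rewrite (_ : wealth n = fun w => cash n w + \1_(holding n) w * W n w).
      by apply: measurable_funD => //; exact: mstep.
    by apply/funext => w; exact: wealthE.
  - move=> w _; rewrite -EFinM lee_fin /wealth lerDl addr_ge0// mulr_ge0//;
    by rewrite indicE.
have : P.-integrable setT U.
  apply/integrableP; split => //.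
  under eq_integral do rewrite gee0_abs//.
  exact: le_lt_trans intU (ltry _).
move=> /(integrable_ae measurableT); apply: filterS => w /(_ I) Ufin.
exists (fine (U w)) => n; rewrite -lee_fin fineK//.
have Uc : cvgn (fun n => (upcross n w)%:E).
  exact: ereal_nondecreasing_is_cvgn.
by apply: (lime_ge Uc); exists n => // k /= /nd.
Qed.

Lemma crosses_upcross w : crosses (W ^~ w) a b ->
  forall N, exists n, N%:R <= upcross n w.
Proof.
move=> [low high].
have hold N : exists2 n, (N <= n)%N & holding n w.
  apply: contrapT => nN.
  have nhold n : (N <= n)%N -> ~ holding n w by move=> Nn Hn; apply: nN; exists n.
  have [[|n] // Nn Wna] := low N.+1.
  by apply: (nhold n.+1); [exact: ltnW|right; split => //; exact: nhold].
have sell N : exists2 n, (N <= n)%N & sale n w.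
  have [m Nm Hm] := hold N; apply: contrapT => nsale.
  have Hall k : holding (m + k) w.
    elim: k => [|k ih]; first by rewrite addn0.
    rewrite addnS; left; split => //=; rewrite ltNge; apply/negP => bW.
    by apply: nsale; exists (m + k)%N => //; rewrite (leq_trans Nm)// leq_addr.
  have [[|n] // mn bW] := high m.+1.
  apply: nsale; exists n; first by rewrite (leq_trans Nm).
  by split => //; have := Hall (n - m)%N; rewrite subnKC.
elim=> [|N [n Nn]]; first by exists 0%N; rewrite /upcross big_ord0.
have [k nk sk] := sell n; exists k.+1.
rewrite /upcross big_ord_recr /= indicE mem_set// -natr1 lerD2r (le_trans Nn)//.
rewrite /upcross -!(big_mkord xpredT (fun k => \1_(sale k) w)).
by rewrite (big_cat_nat (leq0n _) nk)//= lerDl sumr_ge0.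
Qed.

Lemma ae_not_crosses : {ae P, forall w, ~ crosses (W ^~ w) a b}.
Proof.
apply: filterS upcross_bounded => w [C UC] /crosses_upcross cr.
have [n] := cr (Num.truncn C).+1; have := UC n => UnC /le_trans/(_ UnC).
by rewrite leNgt truncnS_gt.
Qed.

End upcrossings.

(** * Nonnegative supermartingales *)

Section supermartingale.
Context d (T : measurableType d) (R : realType) (P : probability T R).
Context (G : nat -> set (set T)) (sG : forall n, <<s G n >> `<=` measurable).
Context (mono : forall n, <<s G n >> `<=` <<s G n.+1 >>).
Context (W V : nat -> T -> R) (W_adapted : forall n, adapted (G n) (W n)).
Context (W_ge0 : forall n w, 0 <= W n w).
Context (mV : forall n, nnmeasurable (V n)).
Context (W_super : forall n, cond_le P (G n) (W n.+1 \+ V n) (W n)).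

Let mW n : nnmeasurable (W n).
Proof. by split => //; exact: (adapted_measurable (@sG n)). Qed.

Let start (N : nat) : set T := [set w | W 0%N w <= N%:R].

Let start_adapted N n : <<s G n >> (start N).
Proof.
elim: n => [|n ih]; last exact: mono.
have -> : start N = W 0%N @^-1` `]-oo, N%:R].
  by apply/seteqP; split => w /=; rewrite /start /= in_itv.
by rewrite -[_ @^-1` _]setTI; exact: W_adapted.
Qed.

Let mstart N : measurable (start N).
Proof. by apply: sG; exact: (@start_adapted N 0). Qed.

Let integral_drift N n :
  (\int[P]_(w in start N) (W n w)%:E +
   \sum_(k < n) \int[P]_(w in start N) (V k w)%:E <= N%:R%:E)%E.
Proof.
elim: n => [|n ih].
  rewrite big_ord0 adde0.
  apply: (@le_trans _ _ (\int[P]_(w in start N) (cst N%:R%:E w))%E).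
    apply: ge0_le_integral => //.
    - by move=> w _; rewrite lee_fin.
    - by apply/measurable_EFinP; apply: measurable_funTS; exact: (mW 0).1.
  rewrite integral_cst// -[leRHS]mule1 lee_wpmul2l ?lee_fin//.
  exact: probability_le1.
apply: le_trans ih; rewrite big_ord_recr /= addeCA [leRHS]addeC leeD2l//.
rewrite -ge0_integralD//.
- by apply: W_super; exact: start_adapted.
- by move=> w _; rewrite lee_fin.
- by apply/measurable_EFinP; apply: measurable_funTS; exact: (mW _).1.
- by move=> w _; rewrite lee_fin (mV _).2.
- by apply/measurable_EFinP; apply: measurable_funTS; exact: (mV _).1.
Qed.

(** [W 0] may have an infinite expectation, so the estimates are localised: the
    events [W 0 <= N] belong to the first sigma-algebra and cover the space. *)
Let ae_finite (f : T -> \bar R) : measurable_fun setT f ->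
  (forall w, 0 <= f w)%E ->
  (forall N, \int[P]_(w in start N) f w <= N%:R%:E)%E ->
  {ae P, forall w, f w < +oo}%E.
Proof.
move=> mf f0 fN.
suff : {ae P, forall w N, start N w -> (f w < +oo)%E}.
  apply: filterS => w fw; apply: (fw (Num.truncn (W 0%N w)).+1).
  by rewrite /start /= ltW// truncnS_gt.
apply: ae_foralln => N.
have : P.-integrable (start N) f.
  apply/integrableP; split; first exact: measurable_funTS.
  under eq_integral do rewrite gee0_abs//.
  exact: le_lt_trans (fN N) (ltry _).
move=> /(integrable_ae (mstart N)); apply: filterS => w fw /fw.
by rewrite ge0_fin_numE.
Qed.

(** Almost surely no pair of rational levels is crossed infinitely often, and
    Fatou's lemma excludes divergence to infinity. *)
Lemma supermartingale_cvg : {ae P, forall w, cvgn (W ^~ w)}.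
Proof.
have W_super' n : cond_le P (G n) (W n.+1) (W n).
  apply: (cond_le_trans _ (@W_super n)); apply: le_cond_le => //.
    split; first by apply: measurable_funD; [exact: (mW _).1|exact: (mV _).1].
    by move=> w; rewrite addr_ge0// (mV _).2.
  by move=> w; rewrite lerDl (mV _).2.
have cross : {ae P, forall w n (p q : rat), unpickle n = Some (p, q) ->
    0 <= (ratr p : R) < ratr q -> ~ crosses (W ^~ w) (ratr p) (ratr q)}.
  apply: ae_foralln => n; case: (unpickle n) => [[p q]|]; last exact: aeW.
  have [/andP[p0 pq]|npq] := boolP (0 <= (ratr p : R) < ratr q); last first.
    by apply: aeW => w p' q' [<- <-]; rewrite (negbTE npq).
  have := ae_not_crosses sG mono W_adapted W_ge0 W_super' p0 pq.
  by apply: filterS => w cw p' q' [<- <-].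
have mE n : measurable_fun setT (fun w => (W n w)%:E).
  by apply/measurable_EFinP; exact: (mW n).1.
have einf : {ae P, forall w, limn_einf (fun n => (W n w)%:E) < +oo}%E.
  apply: ae_finite.
  - under eq_fun do rewrite limn_einf_lim.
    apply: (emeasurable_fun_cvg (fun n w => einfs (fun n => (W n w)%:E) n)).
      exact: measurable_fun_einfs.
    by move=> w _; exact: is_cvg_einfs.
  - move=> w; rewrite limn_einf_lim; apply: lime_ge; first exact: is_cvg_einfs.
    apply: nearW => n; apply: le_ereal_inf_tmp => _ [k _ <-].
    by rewrite lee_fin.
  move=> N; apply: le_trans (fatou _ _ _ _) _ => //.
  - by move=> n; exact: measurable_funTS.
  - by move=> n w _; rewrite lee_fin.
  rewrite limn_einf_lim; apply: lime_le; first exact: is_cvg_einfs.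
  apply: nearW => n; apply: (@le_trans _ _ (\int[P]_(w in start N) (W n w)%:E)%E).
    by apply: ereal_inf_lbound; exists n => /=.
  apply: le_trans (integral_drift N n); rewrite leeDl//.
  apply: sume_ge0 => k _; apply: integral_ge0 => w _.
  by rewrite lee_fin (mV _).2.
apply: filterS2 cross einf => w cw /not_cvgy_infinitely_often[B WB].
apply: crossing_free_cvg WB _ => // p q pq.
by apply: (cw (pickle (p, q))) => //; rewrite pickleK.
Qed.

(** The drifts telescope: their sum has finite expectation on each event
    [W 0 <= N], hence is finite almost surely. *)
Lemma supermartingale_drift_cvg0 :
  {ae P, forall w, V n w @[n --> \oo] --> 0}.
Proof.
have mE n : measurable_fun setT (fun w => (V n w)%:E).
  by apply/measurable_EFinP; exact: (mV n).1.
have VE0 n w : (0 <= (V n w)%:E)%E by rewrite lee_fin (mV n).2.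
have : {ae P, forall w, \sum_(n <oo) (V n w)%:E < +oo}%E.
  apply: ae_finite.
  - by apply: ge0_emeasurable_sum => // n w _ _; exact: VE0.
  - by move=> w; apply: nneseries_ge0.
  move=> N; rewrite integral_nneseries//; last first.
    by move=> n; exact: measurable_funTS.
  apply: lime_le; first by apply: is_cvg_nneseries => n _ _; exact: integral_ge0.
  apply: nearW => n; apply: le_trans (integral_drift N n).
  rewrite big_mkord leeDr//; apply: integral_ge0 => w _.
  by rewrite lee_fin.
apply: filterS => w Vw.
apply: cvg_series_cvg_0; apply: nnseries_is_cvg => // n.
exact: (mV n).2.
Qed.

End supermartingale.

(** * Borel maps into separable Hilbert spaces *)

Section lipschitz.
Context (R : realType) (V U : normedModType R).

Lemma lipschitz_continuous (f : V -> U) (C : R) :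
  (forall x y, `|f x - f y| <= C * `|x - y|) -> continuous f.
Proof.
move=> fC x; apply/cvgrPdist_lt => e e0.
have C0 : 0 < `|C| + 1 by rewrite ltr_wpDl.
near=> y; apply: le_lt_trans (fC x y) _.
apply: (@le_lt_trans _ _ ((`|C| + 1) * `|x - y|)).
  by rewrite ler_wpM2r// (le_trans (ler_norm C))// lerDl.
rewrite mulrC -ltr_pdivlMr//; near: y.
by apply: cvgr_dist_lt; [exact: cvg_id|exact: divr_gt0].
Unshelve. all: by end_near. Qed.

End lipschitz.

Section borel_maps.
Context (R : realType) d (S : measurableType d).

Lemma measurable_fun_ltc (f : S -> R) :
  (forall r, measurable [set s | f s < r]) -> measurable_fun setT f.
Proof.
move=> mf; apply: (measurability _ (RGenInftyO.measurableE R)).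
move=> _ [_ [r ->] <-]; rewrite setTI.
by rewrite (_ : _ @^-1` _ = [set s | f s < r]).
Qed.

Lemma continuous_borel_measurable (V U : hilbertType R) (g : V -> U)
    (f : S -> V) : continuous g ->
  measurable_fun setT (f : S -> borelType V) ->
  measurable_fun setT (g \o f : S -> borelType U).
Proof.
move=> /continuousP cg mf.
apply: (@measurability _ _ S (borelType U) setT _ (@open U)) => //.
move=> _ [A oA <-]; rewrite comp_preimage; apply: mf => //.
by apply: sub_sigma_algebra; exact: cg.
Qed.

Lemma continuous_real_measurable (V : hilbertType R) (g : V -> R)
    (f : S -> V) : continuous g ->
  measurable_fun setT (f : S -> borelType V) -> measurable_fun setT (g \o f).
Proof.
move=> /continuousP cg mf; apply: measurable_fun_ltc => r.
rewrite (_ : [set s | _] = setT `&` f @^-1` (g @^-1` `]-oo, r[)).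
  by apply: mf => //; apply: sub_sigma_algebra; exact/cg/interval_open.
by rewrite setTI; apply/seteqP; split => s /=; rewrite in_itv.
Qed.

Context (V : hilbertType R) (sV : separable V).

(** [`|f - g|] is the infimum of [`|f - q| + `|g - q|] over a dense sequence of
    points [q]. Without separability even the sum of two Borel maps may fail to
    be Borel. *)
Lemma measurable_dist (f g : S -> V) :
  measurable_fun setT (f : S -> borelType V) ->
  measurable_fun setT (g : S -> borelType V) ->
  measurable_fun setT (fun s => `|f s - g s|).
Proof.
move=> mf mg; have [q qd] := separable_seq sV.
have mq (h : S -> V) n : measurable_fun setT (h : S -> borelType V) ->
    measurable_fun setT (fun s => `|h s - q n|).
  apply: (continuous_real_measurable (g := fun v => `|v - q n|)).
  apply: (@lipschitz_continuous _ _ _ _ 1) => x y; rewrite mul1r.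
  by apply: le_trans (ler_dist_dist _ _) _; rewrite opprB addrA subrK.
apply: measurable_fun_ltc => r.
rewrite (_ : [set s | _] =
    \bigcup_n [set s | `|f s - q n| + `|g s - q n| < r]); last first.
  apply/seteqP; split => s /= [].
    rewrite -subr_gt0 => r0; set e := r - _ in r0.
    have [|n fn] := qd (f s) (e / 2); first by rewrite divr_gt0.
    exists n => //=; have : `|g s - q n| <= `|f s - g s| + `|f s - q n|.
      by rewrite -(distrC (g s)) (le_trans _ (ler_normD _ _))// addrA subrK.
    by move: fn; rewrite /e; lra.
  move=> n _ /=; apply: le_lt_trans; rewrite (distrC (g s) (q n)).
  by rewrite (le_trans _ (ler_normD _ _))// addrA subrK.
apply: bigcupT_measurable => n; rewrite -[X in measurable X]setTI.
rewrite (_ : [set s | _] = (fun s => `|f s - q n| + `|g s - q n|) @^-1`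
    `]-oo, r[); last by apply/seteqP; split => s /=; rewrite in_itv.
by apply: measurable_funD => //; exact: mq.
Qed.

(** Pettis: an open set is a countable union of closed balls, and a closed ball
    is a countable intersection of half-spaces. *)
Lemma weakly_measurable (f : S -> V) :
  (forall y, measurable_fun setT (fun s => inner (f s) y)) ->
  measurable_fun setT (f : S -> borelType V).
Proof.
move=> mf; have [q qd] := separable_seq sV.
pose B n k : set V := [set v | `|v - q n| <= k.+1%:R^-1].
have mB n k : measurable (f @^-1` B n k).
  pose h j s := inner (f s) (q j) - inner (q n) (q j).
  have -> : f @^-1` B n k =
      \bigcap_j (h j @^-1` `]-oo, k.+1%:R^-1 * `|q j|]).
    apply/seteqP; split => s /=.
      move=> fs j _ /=; rewrite in_itv /= /h -innerBl.
      by apply: le_trans (inner_le_norm _ _) _; rewrite ler_wpM2r.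
    move=> fs; apply: norm_le_inner_sup => //; set u := f s - q n.
    set r := k.+1%:R^-1 in fs *.
    have r0 : 0 <= r by rewrite /r.
    have fs' j : inner u (q j) <= r * `|q j|.
      by have := fs j I; rewrite /= in_itv /= /h -innerBl.
    move=> y; rewrite leNgt; apply/negP; rewrite -subr_gt0; set e := _ - _ => e0.
    have C0 : 0 < r + `|u| + 1 by rewrite ltr_wpDl// addr_ge0.
    have [|j yj] := qd y (e / (r + `|u| + 1)); first by rewrite divr_gt0.
    move: yj; rewrite ltr_pdivlMr// => yj.
    have := fs' j; have := inner_le_norm u (y - q j); rewrite innerBr.
    have : `|q j| <= `|y| + `|y - q j|.
      by rewrite (distrC y) -{1}(subrK y (q j)) addrC ler_normD.
    move=> qy; have := ler_wpM2l r0 qy; have := normr_ge0 (y - q j).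
    by move: yj; rewrite /e; nra.
  apply: bigcapT_measurable => j; rewrite -[X in measurable X]setTI.
  by apply: measurable_funB => //; exact: mf.
apply: (@measurability _ _ S (borelType V) setT _ (@open V)) => //.
move=> _ [A oA <-]; rewrite setTI.
rewrite (_ : f @^-1` A = \bigcup_n \bigcup_(k in [set k | B n k `<=` A])
    (f @^-1` B n k)).
  by apply: bigcupT_measurable => n; exact: bigcup_measurable.
apply/seteqP; split => s /=; last by move=> [n _ [k BA /BA]].
move=> As; have /nbhs_ballP[e /= e0 eA] : nbhs (f s) A by exact: open_nbhs_nbhs.
have [|k /(_ k (leqnn k)) ke] := @natSinv_lt R (e / 2); first by rewrite divr_gt0.
have k0 : 0 < k.+1%:R^-1 :> R by rewrite invr_gt0.
have [n fn] := qd (f s) _ k0.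
exists n => //; exists k; last by rewrite /= /B /= ltW.
move=> v; rewrite /B /= => vq; apply: eA; rewrite -ball_normE /=.
rewrite -(subrK (q n) (f s)) -addrA (le_lt_trans (ler_normD _ _))//.
by rewrite (distrC _ v); move: ke fn vq; move: (k.+1%:R^-1) => t; lra.
Qed.

End borel_maps.

Section direct_sum.
Context (R : realType) (m : nat) (H : 'I_m -> hilbertType R).

Lemma dsum_normE2 (v : dsum H) : `|v| ^+ 2 = \sum_i `|v i| ^+ 2.
Proof.
rewrite dsum_normrE sqr_sqrtr// sumr_ge0// => i _; exact: sqr_ge0.
Qed.

Lemma dsum_innerE (u v : dsum H) : inner u v = \sum_i inner (u i) (v i).
Proof. by []. Qed.

Lemma coord_continuous i : continuous (fun v : dsum H => v i).
Proof.
apply: (@lipschitz_continuous _ (dsum H) (H i) _ 1) => u v; rewrite mul1r.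
exact: (dsum_norm_ge_coord (u - v) i).
Qed.

Lemma dsum_separable : (forall i, separable (H i)) -> separable (dsum H).
Proof.
move=> sH; pose q i := sval (cid (separable_seq (sH i))).
have qd i : forall x e, 0 < e -> exists n, `|x - q i n| < e.
  by rewrite /q; case: cid.
pose D (k : {ffun 'I_m -> nat}) : dsum H := fun i => q i (k i).
exists (range D); first exact: sub_countable (card_image_le _ _) (countableP _).
move=> O [v Ov] oO.
have /nbhs_ballP[e /= e0 eO] : nbhs v O by exact: open_nbhs_nbhs.
have em : 0 < e / m.+1%:R by rewrite divr_gt0.
have /choice[k kP] : forall i, exists n, `|v i - q i n| < e / m.+1%:R.
  by move=> i; exact: qd.
exists (D [ffun i => k i]); split; last by exists [ffun i => k i].
apply: eO; rewrite -ball_normE /=.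
apply: le_lt_trans (dsum_norm_le_sum _) _.
apply: (@le_lt_trans _ _ (\sum_(i < m) e / m.+1%:R)).
  by apply: ler_sum => i _; apply: ltW; have := kP i; rewrite /D /= -(ffunE k i).
rewrite sumr_const card_ord -(mulr_natr _ m) mulrAC ltr_pdivrMr// ltr_pM2l//.
by rewrite ltr_nat.
Qed.

End direct_sum.

(** * The weighted norm *)

Section weighted_norm.
Context (R : realType) (m : nat) (H : 'I_m -> hilbertType R).
Context (wt : 'I_m -> R) (wt_ge1 : forall i, 1 <= wt i).
Implicit Types u v z : dsum H.

Definition wnorm2 v : R := \sum_i wt i * `|v i| ^+ 2.

(** The operator that represents the weighted inner product in the original one;
    weak convergence is formulated with the latter. *)
Definition wscale v : dsum H := fun i => wt i *: v i.

Let wt_ge0 i : 0 <= wt i.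
Proof. exact: le_trans (wt_ge1 i). Qed.

Lemma wnorm2_ge0 v : 0 <= wnorm2 v.
Proof. by apply: sumr_ge0 => i _; rewrite mulr_ge0// sqr_ge0. Qed.

Lemma normsq_le_wnorm2 v : `|v| ^+ 2 <= wnorm2 v.
Proof.
by rewrite dsum_normE2; apply: ler_sum => i _; rewrite ler_peMl// sqr_ge0.
Qed.

Lemma wnorm2_le v : wnorm2 v <= (\sum_i wt i) * `|v| ^+ 2.
Proof.
rewrite dsum_normE2 mulr_suml; apply: ler_sum => i _.
by rewrite ler_wpM2l// (bigD1 i)//= lerDl sumr_ge0// => j _; exact: sqr_ge0.
Qed.

Lemma wnorm2B u v :
  wnorm2 (u - v) = wnorm2 u - 2 * inner u (wscale v) + wnorm2 v.
Proof.
rewrite /wnorm2 dsum_innerE mulr_sumr -sumrB -big_split /=.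
apply: eq_bigr => i _; rewrite /wscale innerZr.
by rewrite (_ : (u - v) i = u i - v i)// normB_sqr; ring.
Qed.

Lemma inner_wscale u v : inner u (wscale v) = inner (wscale u) v.
Proof.
by rewrite !dsum_innerE; apply: eq_bigr => i _; rewrite innerZr innerZl.
Qed.

Lemma wnorm2E v : wnorm2 v = inner v (wscale v).
Proof.
by rewrite dsum_innerE; apply: eq_bigr => i _; rewrite innerZr inner_normE.
Qed.

Lemma wnorm2_eq0 v : wnorm2 v = 0 -> v = 0.
Proof.
move=> v0; apply/eqP; rewrite -normr_eq0 -sqrf_eq0 eq_le sqr_ge0 andbT -v0.
exact: normsq_le_wnorm2.
Qed.

(** Opial's argument in the weighted norm: when the distance to every point of
    a dense sequence of [F] converges, two weak cluster points in [F] have the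
    same weighted inner product with all differences of points of [F], hence
    coincide. The distance to the weak limit then converges too, and its limit is
    zero as soon as some subsequence converges strongly. *)
Lemma Opial (F : set (dsum H)) (zs : nat -> dsum H) (u : nat -> dsum H) :
  separable (dsum H) ->
  (forall x e, F x -> 0 < e -> exists n, `|x - zs n| < e) ->
  (forall n, cvgn (fun k => wnorm2 (u k - zs n))) ->
  weak_cluster u `<=` F ->
  exists l, [/\ F l, weakly_cvg u l & (strong_cluster u !=set0 -> u @ \oo --> l)].
Proof.
move=> sH zsd u_cvg uF.
have [C uC] : exists C, forall n, `|u n| <= C.
  have [B [_ BP]] := cvg_seq_bounded (u_cvg 0%N).
  have BP' n : wnorm2 (u n - zs 0%N) <= B + 1.
    by apply: le_trans (ler_norm _) _; apply: BP => //; rewrite ltrDl.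
  exists (1 + (B + 1) + `|zs 0%N|) => n.
  rewrite -{1}(subrK (zs 0%N) (u n)) (le_trans (ler_normD _ _))// lerD2r.
  have := le_trans (normsq_le_wnorm2 (u n - zs 0%N)) (BP' n).
  by move: (`|u n - _|) => r; have := sqr_ge0 (r - 1); nra.
pose y n := wscale (zs n - zs 0%N).
have y_cvg n : cvgn (fun k => inner (u k) (y n)).
  rewrite (_ : (fun k => _) = fun k => 2^-1 * (wnorm2 (u k - zs 0%N) -
      wnorm2 (u k - zs n) - wnorm2 (zs 0%N) + wnorm2 (zs n))); last first.
    apply/funext => k; rewrite !wnorm2B /y inner_wscale innerBr -!inner_wscale.
    by field.
  apply: is_cvgM; first exact: is_cvg_cst.
  apply: is_cvgD; last exact: is_cvg_cst.
  apply: is_cvgB; last exact: is_cvg_cst.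
  exact: is_cvgB.
have uniq_cluster l l' : weak_cluster u l -> weak_cluster u l' -> l = l'.
  move=> ul ul'; have lE n : inner l (y n) = inner l' (y n).
    have sub l0 : weak_cluster u l0 ->
        inner l0 (y n) = limn (fun k => inner (u k) (y n)).
      move=> [k kmono /(_ (y n)) kl].
      have kc : inner (u (k j)) (y n) @[j --> \oo] -->
          limn (fun k => inner (u k) (y n)).
        apply: (cvg_comp k (fun k => inner (u k) (y n))); last exact: y_cvg.
        exact: subseq_cvgy.
      exact: cvg_unique kl kc.
    by rewrite !sub.
  have d0 z : F z -> inner (wscale (l - l')) (z - zs 0%N) = 0.
    move=> Fz; apply/eqP/negPn/negP; rewrite -normr_gt0 => c0.
    set c := inner _ _ in c0.
    have C0 : 0 < `|wscale (l - l')| + 1 by rewrite ltr_wpDl.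
    have [|n zn] := zsd z (`|c| / (`|wscale (l - l')| + 1)) Fz.
      by rewrite divr_gt0.
    have cE : c = inner (wscale (l - l')) (z - zs n).
      rewrite -[LHS]subr0 -[X in _ - X](subrr (inner l' (y n))) -{1}(lE n).
      by rewrite -innerBl inner_wscale /c -innerBr opprB addrA subrK.
    move: zn; rewrite ltr_pdivlMr// ltNge => /negP; apply.
    rewrite cE (le_trans (CauchySchwarz _ _))// mulrC ler_wpM2l// lerDl//.
  apply/eqP; rewrite -subr_eq0; apply/eqP/wnorm2_eq0.
  rewrite wnorm2E inner_wscale.
  have <- : (l - zs 0%N) - (l' - zs 0%N) = l - l' by rewrite opprB addrA subrK.
  rewrite innerBr (_ : _ - (l' - zs 0%N) = l - l'); last first.
    by rewrite opprB addrA subrK.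
  by rewrite !d0 ?subr0//; exact: uF.
have [l ul weak_ul] := unique_weak_cluster_cvg sH uC uniq_cluster.
exists l; split => //; first exact: uF.
move=> [l' [k kmono kl']].
have ll' : l = l'.
  apply: uniq_cluster => //; exists k => //; exact: strong_weakly_cvg.
have wl_cvg : cvgn (fun k => wnorm2 (u k - l)).
  rewrite (_ : (fun k => _) = fun k => wnorm2 (u k - zs 0%N) -
    2 * inner (u k) (wscale (l - zs 0%N)) +
    (wnorm2 l - wnorm2 (zs 0%N))); last first.
    apply/funext => j; rewrite !wnorm2B.
    by rewrite !inner_wscale innerBr -!inner_wscale; ring.
  apply: is_cvgD; last exact: is_cvg_cst.
  apply: is_cvgB; first exact: u_cvg.
  apply: is_cvgM; first exact: is_cvg_cst.
  by apply/cvg_ex; eexists; exact: weak_ul.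
have wl0 : wnorm2 (u k - l) @[k --> \oo] --> 0.
  suff -> : 0 = limn (fun k => wnorm2 (u k - l)) by [].
  have kc : wnorm2 (u (k j) - l) @[j --> \oo] -->
      limn (fun k => wnorm2 (u k - l)).
    apply: (cvg_comp k (fun k => wnorm2 (u k - l))); last exact: wl_cvg.
    exact: subseq_cvgy.
  have k0 : wnorm2 (u (k j) - l) @[j --> \oo] --> 0.
    apply: (@squeeze_cvgr _ _ _ _ (cst 0)
      (fun j => (\sum_i wt i) * `|u (k j) - l| ^+ 2)).
    - by apply: nearW => j; rewrite wnorm2_ge0 wnorm2_le.
    - exact: cvg_cst.
    - have kl0 : `|u (k j) - l| @[j --> \oo] --> (0 : R).
        apply/norm_cvg0P; rewrite ll' -[X in _ --> X](subrr l').
        by apply: cvgB; [exact: kl'|exact: cvg_cst].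
      rewrite [X in _ --> X](_ : 0 = (\sum_i wt i) * (0 * 0)); last first.
        by rewrite !mulr0.
      by apply: cvgM; [exact: cvg_cst|exact: cvgM].
  exact: cvg_unique k0 kc.
apply/cvgrPdist_lt => e e0.
have e20 : 0 < e ^+ 2 by rewrite exprn_gt0.
move/cvgrPdist_lt : wl0 => /(_ _ e20); apply: filterS => n.
rewrite sub0r normrN ger0_norm ?wnorm2_ge0// => lt.
rewrite distrC -ltr_sqr ?nnegrE ?(ltW e0)//.
exact: le_lt_trans (normsq_le_wnorm2 _) lt.
Qed.

(** Written with the indicators of the active and of the idle blocks, whose
    expectations are known, as coefficients. *)
Lemma block_step_le (z X X' t A : dsum H) (l b : R) (e : 'I_m -> bool) :
  0 < b -> 0 <= l <= 1 ->
  (forall i, X' i = X i + ((e i)%:R * l) *: (t i + A i - X i)) ->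
  wnorm2 (X' - z) <= (1 + b^-1) * (\sum_i wt i) * `|A| ^+ 2 +
   (\sum_i (1 + b) * wt i * `|X i - z i + l *: (t i - X i)| ^+ 2 * (e i)%:R +
    \sum_i (1 + b) * wt i * `|X i - z i| ^+ 2 * (~~ e i)%:R).
Proof.
move=> b0 /andP[l0 l1] X'E.
have b10 : 0 <= 1 + b^-1 by rewrite addr_ge0// invr_ge0 ltW.
rewrite -big_split /= -mulrA.
apply: (@le_trans _ _ ((1 + b^-1) * wnorm2 A +
    \sum_i ((1 + b) * wt i * `|X i - z i + l *: (t i - X i)| ^+ 2 * (e i)%:R +
    (1 + b) * wt i * `|X i - z i| ^+ 2 * (~~ e i)%:R))); last first.
  by rewrite lerD2r ler_wpM2l// wnorm2_le.
rewrite mulr_sumr -big_split; apply: ler_sum => i _ /=.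
rewrite (_ : (X' - z) i = X' i - z i)// X'E; case: (e i) => /=.
  rewrite mul1r mulr1 mulr0 addr0.
  have -> : X i + l *: (t i + A i - X i) - z i =
      (X i - z i + l *: (t i - X i)) + l *: A i.
    rewrite (addrAC (t i)) scalerDr addrA (addrAC _ _ (- z i)).
    by rewrite (addrAC (X i) _ (- z i)).
  have := normD_sqr_Young (X i - z i + l *: (t i - X i)) (l *: A i) b0.
  move=> /(ler_wpM2l (wt_ge0 i)) /le_trans; apply.
  rewrite mulrDr addrC lerD//; first by rewrite mulrA (mulrC (wt i)).
  rewrite mulrCA ler_wpM2l// ler_wpM2l// normrZ exprMn ler_piMl ?sqr_ge0//.
  by rewrite (ger0_norm l0) exprn_ile1.
rewrite mul0r scale0r addr0 mulr0 mulr1 add0r -[leLHS]add0r lerD//.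
  by rewrite mulr_ge0// mulr_ge0// sqr_ge0.
by rewrite -mulrA ler_peMl ?lerDl ?(ltW b0)// mulr_ge0// sqr_ge0.
Qed.

End weighted_norm.

(** Convexity of the squared norm: summed without weights, the relaxed step
    towards a quasinonexpansive image decreases the distance by a multiple of the
    squared displacement. *)
Lemma relaxed_step_le (R : realType) m (H : 'I_m -> hilbertType R)
    (z X t : dsum H) (l : R) : 0 <= l -> `|t - z| <= `|X - z| ->
  \sum_i `|X i - z i + l *: (t i - X i)| ^+ 2 <=
  \sum_i `|X i - z i| ^+ 2 - l * (1 - l) * `|t - X| ^+ 2.
Proof.
move=> l0 tz; rewrite -(dsum_normE2 (X - z + l *: (t - X))).
rewrite -(dsum_normE2 (X - z)).
have -> : t - X = (t - z) - (X - z) by rewrite opprB addrA subrK.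
rewrite norm_convex_comb_sqr.
rewrite lerD2r; suff : l * `|t - z| ^+ 2 <= l * `|X - z| ^+ 2 by lra.
by rewrite ler_wpM2l// ler_sqr ?nnegrE.
Qed.

(** * The energy of the block iteration *)

Lemma measurable_funV_ge0 d (S : measurableType d) (R : realType) (f : S -> R) :
  (forall s, 0 <= f s) -> measurable_fun setT f ->
  measurable_fun setT (fun s => (f s)^-1).
Proof.
move=> f0 mf; rewrite (_ : (fun s => _) = (fun r => r `^ (-1)) \o f).
  by apply: measurableT_comp => //; exact: measurable_powR.
by apply/funext => s /=; rewrite powR_inv1.
Qed.

Lemma measurable_fun_sqrt d (S : measurableType d) (R : realType) (f : S -> R) :
  measurable_fun setT f -> measurable_fun setT (fun s => Num.sqrt (f s)).
Proof.
move=> mf; apply: (measurableT_comp (f := @Num.sqrt R)) => //.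
by apply: continuous_measurable_fun; exact: sqrt_continuous.
Qed.

Section conditional_domination_instances.
Context d (Omega : measurableType d) (R : realType) (P : probability Omega R).
Context (G : set (set Omega)) (sG : <<s G >> `<=` measurable).

Lemma cond_expectation_adapted (Y Z : Omega -> \bar R) :
  is_cond_expectation P <<s G >> Y Z -> adapted G (fine \o Z).
Proof.
move=> [_ ZG _]; apply: measurableT_comp => // _ B mB.
by rewrite setTI; exact: ZG.
Qed.

Lemma cond_expectation_cond_le (Y : Omega -> R) (Z : Omega -> \bar R) :
  is_cond_expectation P <<s G >> (EFin \o Y) Z ->
  {ae P, forall w, Z w < +oo}%E -> cond_le P G Y (fine \o Z).
Proof.
move=> YZ Zoo A GA; have mA := sG GA.
have mZ := adapted_measurable sG (cond_expectation_adapted YZ).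
have [Z0 ZG ZY] := YZ; rewrite -(ZY _ GA) le_eqVlt; apply/orP; left; apply/eqP.
apply: ge0_ae_eq_integral => //.
- move=> _ B mB; apply: measurableI => //; apply: sG; exact: ZG.
- by apply: measurable_funTS; exact/measurable_EFinP.
- by move=> w _; rewrite lee_fin fine_ge0.
- by apply: filterS Zoo => w Zw _; rewrite /= fineK// ge0_fin_numE.
Qed.

Lemma independent_cond_le (E : set (set Omega)) (A : set Omega) (p : R) :
  independent P E <<s G >> -> measurable A -> E A -> P A = p%:E ->
  cond_le P G (\1_A) (cst p).
Proof.
move=> ind mA EA PA B GB; have mB := sG GB.
rewrite integral_indic// [leRHS](@integral_cst _ _ _ P B mB p%:E).
by rewrite [X in (X <= _)%E](ind _ _ EA GB) PA.
Qed.

End conditional_domination_instances.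

Section history_filtration.
Context d (Omega : measurableType d) (R : realType) (V : hilbertType R).
Context (x : nat -> Omega -> V) (x_random : forall n, random_vector (x n)).

(** Generators of the history, kept apart from the generated sigma-algebra so as
    to serve as the index of a measurable type on the sample space. *)
Definition past n : set (set Omega) :=
  \bigcup_(k in [set k | (k <= n)%N]) preimage_set_system setT (x k) (borel V).

Lemma past_measurable n : <<s past n >> `<=` measurable.
Proof.
apply: smallest_sub; first exact: sigma_algebra_measurable.
by move=> _ [k _ [B mB <-]]; exact: x_random.
Qed.

Lemma past_le k n : (k <= n)%N -> <<s past k >> `<=` <<s past n >>.
Proof.
move=> kn; apply: sub_sigma_algebra2 => A [j /= jk Aj]; exists j => //=.
exact: leq_trans kn.
Qed.

Lemma past_adapted k n (f : Omega -> R) : (k <= n)%N ->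
  adapted (past k) f -> adapted (past n) f.
Proof. by move=> kn mf _ B mB; apply: (past_le kn); exact: mf. Qed.

Lemma present_adapted n :
  measurable_fun setT (x n : g_sigma_algebraType (past n) -> borelType V).
Proof.
by move=> _ B mB; apply: sub_sigma_algebra; exists n => //=; exists B.
Qed.

End history_filtration.

Section block_iteration.
Context (R : realType) (d : measure_display) (Omega : measurableType d).
Context (P : probability Omega R) (m : nat) (H : 'I_m -> hilbertType R).
Context (H_separable : forall i, separable (H i)).
Context (lambda : nat -> R) (lambda01 : forall n, 0 < lambda n < 1).
Context (T : nat -> dsum H -> dsum H).
Context (T_quasinonexpansive : forall n, quasinonexpansive (T n)).
Context (T_measurable : forall n i, measurable_fun setT
  ((fun v => T n v i) : borelType (dsum H) -> borelType (H i))).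
Context (x a : nat -> Omega -> dsum H) (eps : nat -> Omega -> sweep m).
Context (x_random : forall n, random_vector (x n)).
Context (a_random : forall n, random_vector (a n)).
Context (eps_random : forall n, sigma_sweep (eps n) `<=` measurable).
Context (iteration : forall n i, {ae P, forall w,
  x n.+1 w i = x n w i + ((val (eps n w) i)%:R * lambda n) *:
                 (T n (x n w) i + a n w i - x n w i)}).
Context (indep : forall n, independent P (sigma_sweep (eps n)) (history x n)).
Context (p : 'I_m -> R) (p_gt0 : forall i, 0 < p i).
Context (eps_prob : forall n (i : 'I_m), P [set w | val (eps n w) i] = (p i)%:E).
Context (c : nat -> Omega -> \bar R).
Context (c_cond : forall n, is_cond_expectation P (history x n)
  (fun w => (`|a n w| ^+ 2)%:E) (c n)).
Context (c_summable : {ae P, forall w,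
  (\sum_(0 <= n <oo) sqrte (c n w) < +oo)%E}).
Context (kappa : R) (kappa_ge0 : 0 <= kappa).
Context (kappa_le : forall n, kappa <= lambda n * (1 - lambda n)).

Let wt i := (p i)^-1.
Let K := \sum_i wt i.
Let E n (i : 'I_m) : set Omega := [set w | val (eps n w) i].

Let E_sweep n i : sigma_sweep (eps n) (E n i).
Proof. by exists [set e : sweep m | val e i] => //; rewrite setTI. Qed.

Let mE n i : measurable (E n i).
Proof. exact: eps_random. Qed.

Let EC_sweep n i : sigma_sweep (eps n) (~` E n i).
Proof. by exists [set e : sweep m | ~ val e i] => //; rewrite setTI. Qed.

Let p_le1 i : p i <= 1.
Proof. by rewrite -lee_fin -(eps_prob 0); apply: probability_le1; exact: mE. Qed.

Let EC_prob n i : P (~` E n i) = (1 - p i)%:E.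
Proof. by rewrite probability_setC// eps_prob EFinB. Qed.

Let wt_ge1 i : 1 <= wt i.
Proof. by rewrite invf_ge1// ?p_le1. Qed.

Let wt_ge0 i : 0 <= wt i.
Proof. exact: le_trans (wt_ge1 i). Qed.

Let K_ge0 : 0 <= K.
Proof. exact: sumr_ge0. Qed.

Let pastx := past x.

Let sG n : <<s pastx n >> `<=` measurable.
Proof. exact: past_measurable. Qed.

Let c_fin : {ae P, forall w n, (c n w < +oo)%E}.
Proof.
apply: filterS c_summable => w cw n; rewrite ltey; apply/eqP => cnw.
move: cw; rewrite (@nneseries_pinfty _ _ _ n) ?ltxx// ?cnw// => k _.
exact: sqrte_ge0.
Qed.

(** The conditional second moment of the error is finite almost surely, because
    the square roots are summable; it may thus be replaced by a real number. *)
Definition error_moment n w : R := fine (c n w).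

Let gamma := error_moment.

Let gamma_ge0 n w : 0 <= gamma n w.
Proof. by rewrite fine_ge0//; case: (c_cond n). Qed.

Let gamma_adapted n : adapted (pastx n) (gamma n).
Proof. exact: cond_expectation_adapted (c_cond n). Qed.

Let norma2_measurable n : nnmeasurable (fun w => `|a n w| ^+ 2).
Proof.
split; last by move=> w; exact: sqr_ge0.
apply: measurable_funX.
apply: (continuous_real_measurable (g := fun v => `|v|)); last exact: a_random.
exact: norm_continuous.
Qed.

Let gamma_cond_le n : cond_le P (pastx n) (fun w => `|a n w| ^+ 2) (gamma n).
Proof.
apply: (cond_expectation_cond_le (@sG n) (c_cond n)).
by apply: filterS c_fin => w; exact.
Qed.

(** The parameter of Young's inequality at time [n]. Its square dominates the
    conditional error in the weighted norm, and the geometric term, which is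
    summable, keeps it positive where the conditional error vanishes. *)
Definition young n w : R := Num.sqrt (K * gamma n w) + 2^-1 ^+ n.

Definition damping n w : R := \prod_(k < n) ((1 + young k w) ^+ 2)^-1.

Let b := young.
Let D := damping.

Let b_gt0 n w : 0 < b n w.
Proof. by rewrite ltr_wpDl ?sqrtr_ge0// exprn_gt0// invr_gt0. Qed.

Let b1_gt0 n w : 0 < (1 + b n w) ^+ 2.
Proof. by rewrite exprn_gt0// addr_gt0. Qed.

Let b_ge n w : K * gamma n w <= b n w ^+ 2.
Proof.
rewrite -[leLHS]sqr_sqrtr ?mulr_ge0// ler_sqr ?nnegrE ?sqrtr_ge0 ?ltW//.
by rewrite ltrDl exprn_gt0// invr_gt0.
Qed.

Let b_adapted n : adapted (pastx n) (b n).
Proof.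
apply: measurable_funD => //; apply: measurable_fun_sqrt.
by apply: measurable_funM => //; exact: gamma_adapted.
Qed.

Let D_ge0 n w : 0 <= D n w.
Proof. by apply: prodr_ge0 => k _; rewrite invr_ge0 ltW. Qed.

Let DS n w : D n w = D n.+1 w * (1 + b n w) ^+ 2.
Proof. by rewrite /D /damping big_ord_recr /= divfK// gt_eqF. Qed.

Let D_adapted n k : (n <= k.+1)%N -> adapted (pastx k) (D n).
Proof.
move=> nk; rewrite /adapted /D /damping.
under eq_fun do rewrite -(big_mkord xpredT (fun k => ((1 + b k _) ^+ 2)^-1)).
elim: n nk => [|n ih] nk.
  by under eq_fun do rewrite big_nil; exact: measurable_cst.
under eq_fun do rewrite big_nat_recr//=.
apply: measurable_funM; first by apply: ih; exact: ltnW.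
apply: measurable_funV_ge0; first by move=> w; rewrite ltW.
apply: measurable_funX; apply: measurable_funD => //.
by apply: (@past_adapted _ _ _ _ x n k); [exact: nk|exact: b_adapted].
Qed.

Let x_adapted n := @present_adapted _ Omega R (dsum H) x n.

Let coord_adapted n i : measurable_fun setT
  ((fun w => x n w i) : g_sigma_algebraType (pastx n) -> borelType (H i)).
Proof.
exact: (continuous_borel_measurable (@coord_continuous _ _ H i) (@x_adapted n)).
Qed.

Let Tcoord_adapted n i : measurable_fun setT
  ((fun w => T n (x n w) i) : g_sigma_algebraType (pastx n) -> borelType (H i)).
Proof. exact: measurableT_comp (@T_measurable n i) (@x_adapted n). Qed.

Definition displacement2 n w : R := `|T n (x n w) - x n w| ^+ 2.

Let displacement_adapted n : adapted (pastx n) (displacement2 n).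
Proof.
rewrite /adapted /displacement2; under eq_fun do rewrite dsum_normE2.
apply: measurable_sum => i; apply: measurable_funX.
exact: (measurable_dist (H_separable i) (@Tcoord_adapted n i)
  (@coord_adapted n i)).
Qed.

Section reference_point.
Context (z : dsum H) (z_fix : forall n, Fix (T n) z).

Let r n i w : R := `|x n w i - z i| ^+ 2.

Let s n i w : R :=
  `|x n w i - z i + lambda n *: (T n (x n w) i - x n w i)| ^+ 2.

Let r_adapted n i : adapted (pastx n) (r n i).
Proof.
apply: measurable_funX.
apply: (measurable_dist (H_separable i) (@coord_adapted n i)).
exact: measurable_cst.
Qed.

Let s_adapted n i : adapted (pastx n) (s n i).
Proof.
apply: measurable_funX.
have sE w : x n w i - z i + lambda n *: (T n (x n w) i - x n w i) =
    lambda n *: T n (x n w) i - (z i - (1 - lambda n) *: x n w i).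
  by rewrite scalerBl scale1r scalerBr opprB addrCA (addrAC (x n w i)).
under eq_fun do rewrite sE.
apply: (measurable_dist (H_separable i)).
  apply: (continuous_borel_measurable (g := fun v : H i => lambda n *: v))
    (@Tcoord_adapted n i).
  apply: (@lipschitz_continuous _ _ _ _ `|lambda n|) => u v.
  by rewrite -scalerBr normrZ.
apply: (continuous_borel_measurable
  (g := fun v : H i => z i - (1 - lambda n) *: v)) (@coord_adapted n i).
apply: (@lipschitz_continuous _ _ _ _ `|1 - lambda n|) => u v.
by rewrite opprB addrC addrA subrK -scalerBr normrZ (distrC v).
Qed.

(** In expectation, a step multiplies one plus the squared distance by
    [(1 + young n) ^+ 2] at most; dividing by these factors, which the past
    determines, leaves a supermartingale without additive perturbation. *)
Definition energy n w : R := D n w * (1 + wnorm2 wt (x n w - z)).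

Definition drift n w : R := D n.+1 w * (kappa * displacement2 n w).

Let wnorm2_adapted n : adapted (pastx n) (fun w => wnorm2 wt (x n w - z)).
Proof.
by apply: measurable_sum => i; apply: measurable_funM => //; exact: r_adapted.
Qed.

Lemma energy_ge0 n w : 0 <= energy n w.
Proof. by rewrite mulr_ge0// addr_ge0// wnorm2_ge0. Qed.

Lemma energy_adapted n : adapted (pastx n) (energy n).
Proof.
apply: measurable_funM; first exact: D_adapted.
by apply: measurable_funD => //; exact: wnorm2_adapted.
Qed.

Lemma drift_nnmeasurable n : nnmeasurable (drift n).
Proof.
split; last by move=> w; rewrite !mulr_ge0// sqr_ge0.
apply: (adapted_measurable (@sG n)).
apply: measurable_funM; first exact: D_adapted.
by apply: measurable_funM => //; exact: displacement_adapted.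
Qed.

(** The bound on the next energy plus drift, with the squared error [al] and the
    indicators [chi], [chi'] of updated and idle blocks as arguments: its
    conditional expectation given the past is the same expression with these
    three replaced by the conditional second moment and by probabilities. *)
Let bound n (al : Omega -> R) (chi chi' : 'I_m -> Omega -> R) w : R :=
  D n.+1 w * (1 + kappa * displacement2 n w) +
  (D n.+1 w * ((1 + (b n w)^-1) * K) * al w +
   (\sum_i D n.+1 w * ((1 + b n w) * wt i * s n i w) * chi i w +
    \sum_i D n.+1 w * ((1 + b n w) * wt i * r n i w) * chi' i w)).

Let energy_le_bound n : {ae P, forall w, energy n.+1 w + drift n w <=
  bound n (fun w => `|a n w| ^+ 2) (fun i => \1_(E n i))
    (fun i => \1_(~` E n i)) w}.
Proof.
have : {ae P, forall w i, x n.+1 w i = x n w i +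
    ((val (eps n w) i)%:R * lambda n) *: (T n (x n w) i + a n w i - x n w i)}.
  have : {ae P, forall w k (i : 'I_m), k = i :> nat -> x n.+1 w i = x n w i +
      ((val (eps n w) i)%:R * lambda n) *: (T n (x n w) i + a n w i - x n w i)}.
    apply: ae_foralln => k; have [km|mk] := ltnP k m; last first.
      by apply: aeW => w i ki; move: mk; rewrite ki leqNgt ltn_ord.
    apply: filterS (iteration n (Ordinal km)) => w xw i ki.
    by rewrite (_ : i = Ordinal km)//; apply: val_inj.
  by apply: filterS => w xw i; exact: (xw i).
apply: filterS => w xE.
have l01 : 0 <= lambda n <= 1 by have /andP[? ?] := lambda01 n; rewrite !ltW.
have := block_step_le wt_ge1 z (b_gt0 n w) l01 xE.
move=> /(ler_wpM2l (D_ge0 n.+1 w)); rewrite !mulrDr => step.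
have indE i : \1_(E n i) w = (val (eps n w) i)%:R :> R.
  by rewrite indicE; congr (nat_of_bool _)%:R; apply/idP/idP; rewrite inE.
have indCE i : \1_(~` E n i) w = (~~ val (eps n w) i)%:R :> R.
  rewrite indicE in_setC; congr (nat_of_bool (~~ _))%:R.
  by apply/idP/idP; rewrite inE.
rewrite /energy /drift /bound mulrDr [in leRHS]mulrDr.
rewrite [leLHS]addrAC lerD2l.
apply: le_trans step _; rewrite -/K !mulr_sumr.
rewrite le_eqVlt; apply/orP; left; apply/eqP.
congr (_ + (_ + _)); first by rewrite mulrA mulr_sumr.
- by apply: eq_bigr => i _; rewrite indE /s !mulrA.
- by apply: eq_bigr => i _; rewrite indCE /r !mulrA.
Qed.

(** The weights [1 / p i] compensate the probabilities [p i] of an update: in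
    expectation the weighted distance changes by the unweighted difference
    between a full relaxed step and no step. *)
Let bound_le_energy n w :
  bound n (gamma n) (fun i => cst (p i)) (fun i => cst (1 - p i)) w <= energy n w.
Proof.
have l0 : 0 <= lambda n by have /andP[/ltW] := lambda01 n.
have sr_le : \sum_i s n i w <= \sum_i r n i w -
    lambda n * (1 - lambda n) * displacement2 n w.
  exact: relaxed_step_le l0 (T_quasinonexpansive (z_fix n) (x n w)).
have sE : \sum_i D n.+1 w * ((1 + b n w) * wt i * s n i w) * p i =
    D n.+1 w * (1 + b n w) * \sum_i s n i w.
  rewrite mulr_sumr; apply: eq_bigr => i _; rewrite /wt; field.
  by rewrite gt_eqF.
have rE : \sum_i D n.+1 w * ((1 + b n w) * wt i * r n i w) * (1 - p i) =
    D n.+1 w * (1 + b n w) * (wnorm2 wt (x n w - z) - \sum_i r n i w).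
  rewrite /wnorm2 -sumrB mulr_sumr; apply: eq_bigr => i _.
  rewrite -/(r n i w) /wt; field.
  by rewrite gt_eqF.
rewrite /bound /cst sE rE /energy (DS n w).
have q0 : 0 <= wnorm2 wt (x n w - z) by exact: wnorm2_ge0.
have th0 : 0 <= displacement2 n w by exact: sqr_ge0.
have kl := ler_wpM2r th0 (kappa_le n).
have bg : (1 + (b n w)^-1) * K * gamma n w <= b n w ^+ 2 + b n w.
  rewrite -mulrA; apply: le_trans (ler_wpM2l _ (b_ge n w)) _.
    by rewrite addr_ge0// invr_ge0 ltW.
  by rewrite mulrDl mul1r expr2 mulKf ?gt_eqF.
have b0 := b_gt0 n w; have D0 := D_ge0 n.+1 w.
move: (b n w) (D n.+1 w) b0 D0 bg => bb DD b0 D0 bg.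
move: (\sum_i s n i w) (\sum_i r n i w) sr_le => ss sr sr_le.
move: (displacement2 n w) (wnorm2 _ _) th0 q0 kl sr_le => th q th0 q0 kl sr_le.
(* [bb^-1] occurs linearly once its product with [bb] has been simplified. *)
move: (bb^-1) bg => bi bg.
rewrite [leLHS](_ : _ = DD * (1 + kappa * th + ((1 + bi) * K * gamma n w +
    ((1 + bb) * ss + (1 + bb) * (q - sr))))); last by ring.
rewrite [leRHS](_ : _ = DD * ((1 + bb) ^+ 2 * (1 + q))); last by ring.
apply: ler_wpM2l => //.
have sk : ss + kappa * th <= sr.
  by apply: le_trans (lerD sr_le kl) _; rewrite subrK.
have : (1 + bb) * (ss + kappa * th) <= (1 + bb) * sr.
  by rewrite ler_wpM2l// addr_ge0// ltW.
have : 0 <= bb * (kappa * th) by rewrite !mulr_ge0// ltW.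
have : 0 <= bb * q by rewrite mulr_ge0// ltW.
have : 0 <= bb ^+ 2 * q by rewrite mulr_ge0// sqr_ge0.
by move: bg; lra.
Qed.

Let error_coef n w : R := D n.+1 w * ((1 + (b n w)^-1) * K).

Let block_coef (f : nat -> 'I_m -> Omega -> R) n i w : R :=
  D n.+1 w * ((1 + b n w) * wt i * f n i w).

Let error_coef_adapted n : adapted (pastx n) (error_coef n).
Proof.
apply: measurable_funM; first exact: D_adapted.
apply: measurable_funM => //; apply: measurable_funD => //.
apply: measurable_funV_ge0; last exact: b_adapted.
by move=> w; rewrite ltW.
Qed.

Let error_coef_ge0 n w : 0 <= error_coef n w.
Proof. by rewrite !mulr_ge0// addr_ge0// invr_ge0 ltW. Qed.

Let block_coef_adapted f n i : adapted (pastx n) (f n i) ->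
  adapted (pastx n) (block_coef f n i).
Proof.
move=> mf; apply: measurable_funM; first exact: D_adapted.
apply: measurable_funM => //; apply: measurable_funM => //.
by apply: measurable_funD => //; exact: b_adapted.
Qed.

Let block_coef_ge0 (f : nat -> 'I_m -> Omega -> R) n i w : 0 <= f n i w ->
  0 <= block_coef f n i w.
Proof. by move=> f0; rewrite !mulr_ge0// addr_ge0// ltW. Qed.

Let rcoef n i : nnmeasurable (block_coef r n i).
Proof.
apply: (adapted_nnmeasurable (@sG n)).
  by apply: block_coef_adapted; exact: r_adapted.
by move=> w; apply: block_coef_ge0; exact: sqr_ge0.
Qed.

Let scoef n i : nnmeasurable (block_coef s n i).
Proof.
apply: (adapted_nnmeasurable (@sG n)).
  by apply: block_coef_adapted; exact: s_adapted.
by move=> w; apply: block_coef_ge0; exact: sqr_ge0.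
Qed.

Let block_sum_nnmeasurable n (f : nat -> 'I_m -> Omega -> R) chi :
  (forall i, nnmeasurable (block_coef f n i)) ->
  (forall i, nnmeasurable (chi i)) ->
  nnmeasurable (fun w => \sum_i block_coef f n i w * chi i w).
Proof.
by move=> mf mchi; apply: nnmeasurable_sum => i; exact: nnmeasurableM.
Qed.

Let error_term_nnmeasurable n al : nnmeasurable al ->
  nnmeasurable (fun w => error_coef n w * al w).
Proof.
move=> mal; apply: nnmeasurableM => //.
exact: (adapted_nnmeasurable (@sG n) (@error_coef_adapted n) (error_coef_ge0 n)).
Qed.

Let displacement_term_nnmeasurable n :
  nnmeasurable (fun w => D n.+1 w * (1 + kappa * displacement2 n w)).
Proof.
apply: (adapted_nnmeasurable (@sG n)).
  apply: measurable_funM; first exact: D_adapted.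
  apply: measurable_funD => //; apply: measurable_funM => //.
  exact: displacement_adapted.
by move=> w; rewrite mulr_ge0// addr_ge0// mulr_ge0// sqr_ge0.
Qed.

Let bound_nnmeasurable n al chi chi' : nnmeasurable al ->
  (forall i, nnmeasurable (chi i)) -> (forall i, nnmeasurable (chi' i)) ->
  nnmeasurable (bound n al chi chi').
Proof.
move=> mal mchi mchi'; apply: nnmeasurableD => //.
apply: nnmeasurableD; first exact: error_term_nnmeasurable.
by apply: nnmeasurableD; exact: block_sum_nnmeasurable.
Qed.

Let bound_cond_le n : cond_le P (pastx n)
  (bound n (fun w => `|a n w| ^+ 2) (fun i => \1_(E n i))
    (fun i => \1_(~` E n i)))
  (bound n (gamma n) (fun i => cst (p i)) (fun i => cst (1 - p i))).
Proof.
have mg : nnmeasurable (gamma n).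
  exact: (adapted_nnmeasurable (@sG n) (@gamma_adapted n) (gamma_ge0 n)).
have mEi i : nnmeasurable (\1_(E n i) : Omega -> R) by exact: nnmeasurable_indic.
have mECi i : nnmeasurable (\1_(~` E n i) : Omega -> R).
  by apply: nnmeasurable_indic; exact: measurableC.
have mp i : nnmeasurable (cst (p i) : Omega -> R).
  by apply: nnmeasurable_cst; exact: ltW.
have mp' i : nnmeasurable (cst (1 - p i) : Omega -> R).
  by apply: nnmeasurable_cst; rewrite subr_ge0.
have block_cond_le f (A : 'I_m -> set Omega) q :
    (forall i, adapted (pastx n) (f n i)) -> (forall i w, 0 <= f n i w) ->
    (forall i, nnmeasurable (block_coef f n i)) ->
    (forall i, measurable (A i)) -> (forall i, sigma_sweep (eps n) (A i)) ->
    (forall i, P (A i) = (q i)%:E) -> (forall i, 0 <= q i) ->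
    cond_le P (pastx n) (fun w => \sum_i block_coef f n i w * \1_(A i) w)
      (fun w => \sum_i block_coef f n i w * cst (q i) w).
  move=> mf f0 mcf mA sA PA q0.
  have mAi i : nnmeasurable (\1_(A i) : Omega -> R) by exact: nnmeasurable_indic.
  have mqi i : nnmeasurable (cst (q i) : Omega -> R) by exact: nnmeasurable_cst.
  apply: (cond_le_sum (@sG n)) => i; first exact: nnmeasurableM.
    exact: nnmeasurableM.
  apply: (cond_le_mul (@sG n)) => //; first exact: block_coef_adapted.
    by move=> w; exact: block_coef_ge0.
  exact: (independent_cond_le (@sG n) (@indep n)).
apply: (cond_le_add (@sG n)) => //.
- apply: nnmeasurableD; first exact: error_term_nnmeasurable.
  by apply: nnmeasurableD; exact: block_sum_nnmeasurable.
- apply: nnmeasurableD; first exact: error_term_nnmeasurable.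
  by apply: nnmeasurableD; exact: block_sum_nnmeasurable.
apply: (cond_le_add (@sG n)).
- exact: error_term_nnmeasurable.
- exact: error_term_nnmeasurable.
- by apply: nnmeasurableD; exact: block_sum_nnmeasurable.
- by apply: nnmeasurableD; exact: block_sum_nnmeasurable.
- apply: (cond_le_mul (@sG n) (@norma2_measurable n) mg (@error_coef_adapted n)
    (error_coef_ge0 n)).
  exact: gamma_cond_le.
apply: (cond_le_add (@sG n)); try exact: block_sum_nnmeasurable.
- apply: block_cond_le => // i; [move=> w; exact: sqr_ge0|exact: eps_prob|].
  exact: ltW.
- apply: block_cond_le => // i; [move=> w; exact: sqr_ge0|exact: measurableC|].
  by rewrite subr_ge0.
Qed.

Lemma energy_super n :
  cond_le P (pastx n) (energy n.+1 \+ drift n) (energy n).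
Proof.
have nn_energy k : nnmeasurable (energy k).
  exact: (adapted_nnmeasurable (@sG k) (@energy_adapted k) (energy_ge0 k)).
have mEi i : nnmeasurable (\1_(E n i) : Omega -> R) by exact: nnmeasurable_indic.
have mECi i : nnmeasurable (\1_(~` E n i) : Omega -> R).
  by apply: nnmeasurable_indic; exact: measurableC.
have step : cond_le P (pastx n) (energy n.+1 \+ drift n)
    (bound n (fun w => `|a n w| ^+ 2) (fun i => \1_(E n i))
      (fun i => \1_(~` E n i))).
  apply: (ae_cond_le (@sG n) _ _ (energy_le_bound n)).
    by apply: nnmeasurableD => //; exact: drift_nnmeasurable.
  exact: bound_nnmeasurable.
apply: (cond_le_trans (cond_le_trans step (@bound_cond_le n))).
have nn_bound : nnmeasurable (bound n (gamma n) (fun i => cst (p i))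
    (fun i => cst (1 - p i))).
  apply: bound_nnmeasurable.
  - exact: (adapted_nnmeasurable (@sG n) (@gamma_adapted n) (gamma_ge0 n)).
  - by move=> i; apply: nnmeasurable_cst; exact: ltW.
  - by move=> i; apply: nnmeasurable_cst; rewrite subr_ge0.
exact: (@le_cond_le _ _ _ P _ (@sG n) _ _ nn_bound (nn_energy n)
  (bound_le_energy n)).
Qed.

Lemma ae_energy_cvg : {ae P, forall w, cvgn (energy ^~ w)}.
Proof.
apply: (supermartingale_cvg sG _ energy_adapted energy_ge0
  drift_nnmeasurable energy_super).
by move=> n; exact: past_le.
Qed.

Lemma ae_drift_cvg0 : {ae P, forall w, drift n w @[n --> \oo] --> 0}.
Proof.
apply: (supermartingale_drift_cvg0 sG _ energy_adapted energy_ge0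
  drift_nnmeasurable energy_super).
by move=> n; exact: past_le.
Qed.

End reference_point.


(** Summability of the parameters [young n] keeps the product of the factors
    [(1 + young n) ^+ 2] bounded: damping does not destroy the energy. *)
Lemma ae_damping_cvg :
  {ae P, forall w, exists2 l : R, 0 < l & damping n w @[n --> \oo] --> l}.
Proof.
apply: filterS2 c_summable c_fin => w csum cfin.
have sqrteE n : sqrte (c n w) = (Num.sqrt (gamma n w))%:E.
  have c0 : (0 <= c n w)%E by case: (c_cond n).
  have cE : c n w \is a fin_num by rewrite ge0_fin_numE.
  by rewrite /gamma /error_moment -{1}(fineK cE).
pose M := fine (\sum_(0 <= n <oo) sqrte (c n w))%E.
have sum_sqrt n : \sum_(k < n) Num.sqrt (gamma k w) <= M.
  rewrite -lee_fin fineK; last first.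
    by rewrite ge0_fin_numE// nneseries_ge0// => k _ _; exact: sqrte_ge0.
  rewrite -sumEFin; under eq_bigr do rewrite -sqrteE.
  rewrite -(big_mkord xpredT (fun k => sqrte (c k w))).
  by apply: nneseries_lim_ge => k _ _; exact: sqrte_ge0.
have sum_geom n : \sum_(k < n) (2^-1 : R) ^+ k <= 2.
  suff -> : \sum_(k < n) (2^-1 : R) ^+ k = 2 - 2 * 2^-1 ^+ n.
    by rewrite gerBl mulr_ge0// exprn_ge0// invr_ge0.
  elim: n => [|n ih]; first by rewrite big_ord0 expr0; lra.
  by rewrite big_ord_recr /= ih exprS; field.
pose B := Num.sqrt K * M + 2.
have sum_b n : \sum_(k < n) b k w <= B.
  rewrite /b /young big_split /= lerD ?sum_geom//.
  under eq_bigr do rewrite sqrtrM//.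
  by rewrite -mulr_sumr ler_wpM2l ?sqrtr_ge0 ?sum_sqrt.
have D_exp n : expR (- (2 * \sum_(k < n) b k w)) <= D n w.
  elim: n => [|n ih]; first by rewrite /D /damping !big_ord0 mulr0 oppr0 expR0.
  rewrite /D /damping !big_ord_recr /= mulrDr opprD expRD ler_pM ?expR_ge0//.
  rewrite expRN lef_pV2 ?posrE ?expR_gt0 ?b1_gt0//.
  have b10 : 0 <= 1 + b n w by rewrite addr_ge0// ltW.
  by rewrite mulr_natl mulr2n expRD -expr2 ler_sqr ?nnegrE ?expR_ge0 ?expR_ge1Dx.
have D_ge n : expR (- (2 * B)) <= D n w.
  by apply: le_trans (D_exp n); rewrite ler_expR lerN2 ler_wpM2l.
have D_nincr : nonincreasing_seq (D ^~ w).
  apply/nonincreasing_seqP => n; rewrite (DS n w) ler_peMr//.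
  by rewrite exprn_ege1// lerDl ltW.
have D_cvg : cvgn (D ^~ w).
  apply: nonincreasing_is_cvgn => //.
  by exists (expR (- (2 * B))) => _ [n _ <-].
exists (limn (D ^~ w)) => //.
apply: lt_le_trans (expR_gt0 (- (2 * B))) _.
by apply: limr_ge => //; apply: nearW.
Qed.

(** The energy and its damping factor converge, the latter to a positive limit. *)
Lemma ae_wnorm2_cvg (z : dsum H) : (forall n, Fix (T n) z) ->
  {ae P, forall w, cvgn (fun n => wnorm2 wt (x n w - z))}.
Proof.
move=> z_fix; apply: filterS2 ae_damping_cvg (ae_energy_cvg z_fix) => w.
move=> [l l0 Dl] energy_cvg.
rewrite (_ : (fun n => _) = fun n => energy z n w * (D n w)^-1 - 1).
  apply: is_cvgB; last exact: is_cvg_cst.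
  apply: is_cvgM => //; apply/cvg_ex; exists l^-1; apply: cvgV => //.
  by rewrite gt_eqF.
apply/funext => n; rewrite /energy mulrAC divff ?mul1r; last first.
  by rewrite gt_eqF// prodr_gt0// => k _; rewrite invr_gt0.
by rewrite [RHS]addrAC subrr add0r.
Qed.

Lemma ae_displacement_cvg0 (z : dsum H) : (forall n, Fix (T n) z) ->
  0 < kappa -> {ae P, forall w, T n (x n w) - x n w @[n --> \oo] --> 0}.
Proof.
move=> z_fix kappa0.
apply: filterS2 ae_damping_cvg (ae_drift_cvg0 z_fix) => w [l l0 Dl] drift0.
have disp0 : displacement2 n w @[n --> \oo] --> (0 : R).
  rewrite (_ : (fun n => _) = fun n => drift n w * (kappa * D n.+1 w)^-1).
    rewrite [X in _ --> X](_ : 0 = 0 * (kappa * l)^-1); last by rewrite mul0r.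
    apply: cvgM => //; apply: cvgV; first by rewrite mulf_neq0 ?gt_eqF.
    by apply: cvgM; [exact: cvg_cst|rewrite (cvg_shiftS (D ^~ w))].
  apply/funext => n; rewrite /drift mulrCA mulrA [RHS]mulrAC divff ?mul1r//.
  by rewrite mulf_neq0 ?gt_eqF// prodr_gt0// => k _; rewrite invr_gt0.
apply/cvgr0Pnorm_lt => e e0.
have e20 : 0 < e ^+ 2 by rewrite exprn_gt0.
move/cvgr0Pnorm_lt : disp0 => /(_ _ e20); apply: filterS => n.
rewrite ger0_norm ?sqr_ge0// /displacement2.
by rewrite ltr_sqr ?nnegrE// ltW.
Qed.

End block_iteration.

(** * Convergence of the iteration *)

Theorem theorem3p2
  (R : realType) (d : measure_display) (Omega : measurableType d)
  (P : probability Omega R)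
  (m : nat) (H : 'I_m -> hilbertType R)
  (H_separable : forall i, separable (H i))
  (lambda : nat -> R)
  (lambda01 : forall n, 0 < lambda n < 1)
  (lambda_inf : 0 < inf (range lambda))
  (lambda_sup : sup (range lambda) < 1)
  (T : nat -> dsum H -> dsum H)
  (T_quasinonexpansive : forall n, quasinonexpansive (T n))
  (T_measurable : forall n i, measurable_fun setT
     ((fun v => T n v i) : borelType (dsum H) -> borelType (H i)))
  (x a : nat -> Omega -> dsum H) (eps : nat -> Omega -> sweep m)
  (x_random : forall n, random_vector (x n))
  (a_random : forall n, random_vector (a n))
  (eps_random : forall n, sigma_sweep (eps n) `<=` measurable)
  (eps_identically_distributed : forall n (B : set (sweep m)),
     P (eps n @^-1` B) = P (eps 0%N @^-1` B))
  (iteration : forall n i, {ae P, forall w,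
     x n.+1 w i = x n w i + ((val (eps n w) i)%:R * lambda n) *:
                    (T n (x n w) i + a n w i - x n w i)})
  (F := \bigcap_(n in [set: nat]) Fix (T n))
  (hi : F !=set0)
  (hii : exists2 c : nat -> Omega -> \bar R,
     forall n, is_cond_expectation P (history x n)
                 (fun w => (`|a n w| ^+ 2)%:E) (c n) &
     {ae P, forall w, (\sum_(0 <= n <oo) sqrte (c n w) < +oo)%E})
  (hiii : forall n, independent P (sigma_sweep (eps n)) (history x n))
  (hiv : forall i, (0 < P [set w | val (eps 0%N w) i])%E) :
  {ae P, forall w, T n (x n w) - x n w @[n --> \oo] --> 0} /\
  ({ae P, forall w, weak_cluster (x ^~ w) `<=` F} ->
   exists X : Omega -> dsum H,
     [/\ random_vector X,
         (forall w, F (X w)),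
         {ae P, forall w, weakly_cvg (x ^~ w) (X w)} &
         ({ae P, forall w, strong_cluster (x ^~ w) !=set0} ->
          {ae P, forall w, x n w @[n --> \oo] --> X w})]).
Proof.
(* A lower bound of all the coefficients [lambda n * (1 - lambda n)]. *)
pose kappa := inf (range lambda) * (1 - sup (range lambda)).
have lambda_lbound : has_lbound (range lambda).
  by exists 0 => _ [n _ <-]; have /andP[/ltW] := lambda01 n.
have lambda_ubound : has_ubound (range lambda).
  by exists 1 => _ [n _ <-]; have /andP[_ /ltW] := lambda01 n.
have kappa_gt0 : 0 < kappa by rewrite mulr_gt0// subr_gt0.
have kappa_le n : kappa <= lambda n * (1 - lambda n).
  apply: ler_pM; [exact: ltW|by rewrite subr_ge0 ltW| |].
    by apply: ge_inf => //; exists n.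
  by rewrite lerD2l lerN2; apply: ub_le_sup => //; exists n.
pose p i := fine (P [set w | val (eps 0%N w) i]).
have mE (i : 'I_m) : measurable [set w | val (eps 0%N w) i].
  apply: (@eps_random 0%N); exists [set e : sweep m | val e i] => //.
  by rewrite setTI.
have pE i : P [set w | val (eps 0%N w) i] = (p i)%:E.
  by rewrite fineK// fin_num_measure.
have eps_prob n (i : 'I_m) : P [set w | val (eps n w) i] = (p i)%:E.
  rewrite -pE; exact: (eps_identically_distributed n [set e : sweep m | val e i]).
have p_gt0 i : 0 < p i by rewrite -lte_fin -pE.
have Fix_F z : F z -> forall n, Fix (T n) z by move=> Fz n; exact: Fz.
have [c c_cond c_summable] := hii; have [z0 Fz0] := hi.
have kappa_ge0 := ltW kappa_gt0.
split.
  exact: (ae_displacement_cvg0 H_separable lambda01 T_quasinonexpansive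
    T_measurable x_random a_random eps_random iteration hiii p_gt0 eps_prob
    c_cond c_summable kappa_ge0 kappa_le (Fix_F z0 Fz0) kappa_gt0).
move=> weak_in_F.
pose wt i := (p i)^-1.
have sH := dsum_separable H_separable.
have wt_ge1 i : 1 <= wt i.
  by rewrite invf_ge1// -lee_fin -pE probability_le1.
have [zs [Fzs zs_dense]] := separable_subset_seq sH hi.
have zs_cvg : {ae P, forall w k, cvgn (fun n => wnorm2 wt (x n w - zs k))}.
  apply: ae_foralln => k.
  exact: (ae_wnorm2_cvg H_separable lambda01 T_quasinonexpansive
    T_measurable x_random a_random eps_random iteration hiii p_gt0 eps_prob
    c_cond c_summable kappa_ge0 kappa_le (Fix_F (zs k) (Fzs k))).
(* The exceptional set may fail to be measurable: the limit is set to a fixed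
   point on a measurable null set [N] that contains it. *)
have [N [mN PN goodN]] : {ae P, forall w, exists l, [/\ F l,
    weakly_cvg (x ^~ w) l &
    (strong_cluster (x ^~ w) !=set0 -> x n w @[n --> \oo] --> l)]}.
  apply: filterS2 zs_cvg weak_in_F => w.
  exact: (Opial wt_ge1 sH zs_dense).
have /choice[X XP] : forall w, exists l, (N w -> l = z0) /\ (~ N w -> [/\ F l,
    weakly_cvg (x ^~ w) l &
    (strong_cluster (x ^~ w) !=set0 -> x n w @[n --> \oo] --> l)]).
  move=> w; have [Nw|nNw] := pselect (N w); first by exists z0.
  have [l lP] : exists l, [/\ F l, weakly_cvg (x ^~ w) l &
      (strong_cluster (x ^~ w) !=set0 -> x n w @[n --> \oo] --> l)].
    by apply: contrapT => nl; apply: nNw; exact: goodN.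
  by exists l.
have notN : {ae P, forall w, ~ N w}.
  by exists N; split => // w /=; rewrite notK.
exists X; split.
- apply: (weakly_measurable sH) => y.
  pose g n w := \1_N w * inner z0 y + \1_(~` N) w * inner (x n w) y.
  apply: (measurable_fun_cvg (h := g)) => [n|w _].
    apply: measurable_funD; apply: measurable_funM => //.
    - by apply: measurable_indic; exact: measurableC.
    - apply: (continuous_real_measurable (g := fun v => inner v y))
        (x_random n).
      apply: (@lipschitz_continuous _ _ _ _ `|y|) => u v.
      by rewrite -innerBl mulrC CauchySchwarz.
  rewrite /g !indicE in_setC; have [XN XnN] := XP w.
  case: (boolP (w \in N)); rewrite ?inE ?notin_setE => Nw /=.
    rewrite (XN Nw); under eq_fun do rewrite mul1r mul0r addr0.
    exact: cvg_cst.
  under eq_fun do rewrite mul0r mul1r add0r.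
  by have [_ + _] := XnN Nw; exact.
- move=> w; have [XN XnN] := XP w.
  by have [/XN->//|/XnN[]] := pselect (N w).
- by apply: filterS notN => w /(XP w).2[].
- by move=> strong; apply: filterS2 notN strong => w /(XP w).2[_ _].
Qed.
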